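(* Let $\Lambda$ and $\Gamma$ be left and right noetherian rings and let ${}_{\Lambda}U_{\Gamma}$ be a faithfully balanced selforthogonal bimodule, with ${}_{\Lambda}U$ and $U_{\Gamma}$ finitely generated, which is a Gorenstein bimodule. Let $g$ be a non-negative integer. (1) If the injective dimension of the right $\Gamma$-module $U_{\Gamma}$ is $g$, then for any $0\neq M\in\mathcal{G}_g(\mathrm{mod}\,\Lambda)$, $M\cong\mathrm{Ext}^g_{\Gamma}(\mathrm{Ext}^g_{\Lambda}(M,U),U)$. (2) If the injective dimension of $U_{\Gamma}$ and the injective dimension of ${}_{\Lambda}U$ are both equal to $g$, then there is a duality between $\mathcal{G}_g(\mathrm{mod}\,\Lambda)$ and $\mathcal{G}_g(\mathrm{mod}\,\Gamma^{op})$ given by $M\mapsto\mathrm{Ext}^g_{\Lambda}(M,U)$.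
   Context: $\mathrm{mod}\,\Lambda$ is the category of finitely generated left $\Lambda$-modules and $\mathrm{mod}\,\Gamma^{op}$ the category of finitely generated right $\Gamma$-modules. For $M\in\mathrm{mod}\,\Lambda$, $\mathrm{Ext}^i_{\Lambda}(M,U)$ is a right $\Gamma$-module; for $N\in\mathrm{mod}\,\Gamma^{op}$, $\mathrm{Ext}^i_{\Gamma}(N,U)$ is a left $\Lambda$-module; $\mathrm{Ext}^0=\mathrm{Hom}$. ${}_{\Lambda}U_{\Gamma}$ is faithfully balanced if the natural maps $\Lambda\to\mathrm{End}(U_{\Gamma})$ and $\Gamma\to\mathrm{End}({}_{\Lambda}U)^{op}$ are isomorphisms; it is selforthogonal if $\mathrm{Ext}^i_{\Lambda}({}_{\Lambda}U,{}_{\Lambda}U)=0$ and $\mathrm{Ext}^i_{\Gamma}(U_{\Gamma},U_{\Gamma})=0$ for all $i\geq 1$. For $A$ in $\mathrm{mod}\,\Lambda$ (resp. $\mathrm{mod}\,\Gamma^{op}$): $\mathrm{grade}_U A\geq i$ means $\mathrm{Ext}^j(A,U)=0$ (over $\Lambda$, resp. $\Gamma$) for all $0\leq j<i$; $\mathrm{grade}_U A=g$ means $\mathrm{grade}_U A\ge g$ but not $\mathrm{grade}_U A\ge g+1$; $\mathrm{s.grade}_U A\geq i$ means $\mathrm{grade}_U B\geq i$ for all submodules $B$ of $A$. ${}_{\Lambda}U_{\Gamma}$ is a Gorenstein bimodule if $\mathrm{s.grade}_U\mathrm{Ext}^i_{\Gamma}(N,U)\geq i$ for all $N\in\mathrm{mod}\,\Gamma^{op}$,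 $i\geq 1$, and $\mathrm{s.grade}_U\mathrm{Ext}^i_{\Lambda}(M,U)\geq i$ for all $M\in\mathrm{mod}\,\Lambda$, $i\geq 1$. $\mathcal{G}_g(\mathrm{mod}\,\Lambda)$ (resp. $\mathcal{G}_g(\mathrm{mod}\,\Gamma^{op})$) is the full subcategory of $\mathrm{mod}\,\Lambda$ (resp. $\mathrm{mod}\,\Gamma^{op}$) consisting of the modules $M$ with $\mathrm{grade}_U M=g$. A duality is a contravariant equivalence. *)

(* Defs.v *)
From HB Require Import structures.
From mathcomp Require Import all_boot all_order all_algebra.
From mathcomp Require Import finmap boolp classical_sets functions cardinality fsbigop.

Set Implicit Arguments.
Unset Strict Implicit.
Unset Printing Implicit Defensive.

Import GRing.Theory.
Local Open Scope ring_scope.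
Local Open Scope quotient_scope.

(** Rings are not assumed commutative.  A left [R]-module is an [lmodType R],
    a right [R]-module is an [lmodType (opring R)]. *)

Definition opring (R : pzRingType) : pzRingType := R^c.

Record submod (R : pzRingType) (V : lmodType R) (S : submodClosed V) :=
  Submod { submod_val : V; submod_valP : submod_val \in S }.

HB.instance Definition _ R (V : lmodType R) (S : submodClosed V) :=
  [isSub for @submod_val R V S].
HB.instance Definition _ R (V : lmodType R) (S : submodClosed V) :=
  [Choice of submod S by <:].
HB.instance Definition _ R (V : lmodType R) (S : submodClosed V) :=
  [SubChoice_isSubLmodule of submod S by <:].

Fact submod_val_linear R (V : lmodType R) (S : submodClosed V) :
  linear (@submod_val R V S).
Proof. by []. Qed.
HB.instance Definition _ R (V : lmodType R) (S : submodClosed V) :=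
  GRing.isLinear.Build R (submod S) V _ (@submod_val R V S)
    (@submod_val_linear R V S).

Section SubQuot.
Variables (R : pzRingType) (V W : lmodType R).

Definition ker (f : {linear V -> W}) : {pred V} := [pred x | f x == 0].

Lemma kerP (f : {linear V -> W}) x : reflect (f x = 0) (x \in ker f).
Proof. exact: eqP. Qed.

Lemma ker_closed (f : {linear V -> W}) : submod_closed (ker f).
Proof.
split=> [|a x y]; first by apply/kerP; rewrite linear0.
move=> /kerP fx /kerP fy; apply/kerP.
by rewrite linearP fx fy scaler0 addr0.
Qed.

HB.instance Definition _ (f : {linear V -> W}) :=
  GRing.isSubmodClosed.Build R V (ker f) (ker_closed f).

Definition im (f : {linear V -> W}) : {pred W} := [pred y | `[< exists x, f x = y >]].

Lemma imP (f : {linear V -> W}) y : reflect (exists x, f x = y) (y \in im f).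
Proof. exact: asboolP. Qed.

Lemma im_closed (f : {linear V -> W}) : submod_closed (im f).
Proof.
split=> [|a x y]; first by apply/imP; exists 0; rewrite linear0.
move=> /imP[u <-] /imP[v <-]; apply/imP; exists (a *: u + v).
by rewrite linearP.
Qed.

HB.instance Definition _ (f : {linear V -> W}) :=
  GRing.isSubmodClosed.Build R W (im f) (im_closed f).

Definition preim_sub (f : V -> W) (T : {pred W}) : {pred V} := [pred x | f x \in T].

Lemma preim_sub_closed (f : {linear V -> W}) (T : submodClosed W) :
  submod_closed (preim_sub f T).
Proof.
split=> [|a x y]; rewrite !inE ?linear0 ?rpred0 // => fx fy.
by rewrite linearP rpredD // rpredZ.
Qed.

HB.instance Definition _ (f : {linear V -> W}) (T : submodClosed W) :=
  GRing.isSubmodClosed.Build R V (preim_sub f T) (preim_sub_closed f T).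

Definition zmod_pred (S : {pred V}) : {pred V} := S.

Lemma zmod_pred_closed (S : submodClosed V) : zmod_closed (zmod_pred S).
Proof.
split=> [|x y]; rewrite /zmod_pred; first exact: rpred0.
by move=> Sx Sy; rewrite -scaleN1r rpredD // rpredZ.
Qed.

HB.instance Definition _ (S : submodClosed V) :=
  GRing.isZmodClosed.Build V (zmod_pred S) (zmod_pred_closed S).

End SubQuot.

Section Quotmod.
Variables (R : pzRingType) (V : lmodType R) (S : submodClosed V).

Definition quotmod := Quotient.quot (zmod_pred S).
HB.instance Definition _ := GRing.Zmodule.on quotmod.

Definition pi_mod (x : V) : quotmod := \pi_(Quotient.quot (zmod_pred S)) x.

Lemma pi_modP x y : (pi_mod x = pi_mod y) <-> (x - y \in S).
Proof.
split=> [E|E]; last by apply/eqP; rewrite -[_ == _]Quotient.idealrBE.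
have : x - y \in zmod_pred S by rewrite Quotient.idealrBE; apply/eqP.
by [].
Qed.

Lemma pi_mod_repr (q : quotmod) : pi_mod (repr q) = q.
Proof. exact: reprK. Qed.

Lemma pi_modD x y : pi_mod (x + y) = pi_mod x + pi_mod y.
Proof. by rewrite /pi_mod raddfD. Qed.

Definition quot_scale a (q : quotmod) : quotmod := pi_mod (a *: repr q).

Lemma quot_scaleE a x : quot_scale a (pi_mod x) = pi_mod (a *: x).
Proof.
apply/pi_modP; rewrite -scalerBr rpredZ //.
by apply/pi_modP; rewrite pi_mod_repr.
Qed.

Fact quot_scaleA a b q : quot_scale a (quot_scale b q) = quot_scale (a * b) q.
Proof. by rewrite -(pi_mod_repr q) !quot_scaleE scalerA. Qed.
Fact quot_scale1 : left_id 1 quot_scale.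
Proof. by move=> q; rewrite -(pi_mod_repr q) quot_scaleE scale1r. Qed.
Fact quot_scaleDr : right_distributive quot_scale +%R.
Proof.
move=> a p q; rewrite -(pi_mod_repr q) -(pi_mod_repr p).
by rewrite -pi_modD !quot_scaleE scalerDr pi_modD.
Qed.
Fact quot_scaleDl q : {morph quot_scale^~ q : a b / a + b}.
Proof.
by move=> a b /=; rewrite -(pi_mod_repr q) !quot_scaleE scalerDl pi_modD.
Qed.

HB.instance Definition _ := GRing.Zmodule_isLmodule.Build R quotmod
  quot_scaleA quot_scale1 quot_scaleDr quot_scaleDl.

Fact pi_mod_linear : linear pi_mod.
Proof. by move=> a x y; rewrite pi_modD -quot_scaleE. Qed.
HB.instance Definition _ := GRing.isLinear.Build R V quotmod _ pi_mod pi_mod_linear.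

End Quotmod.

Section Induced.
Variables (R : pzRingType) (V W : lmodType R) (f : {linear V -> W}).
Variables (S : submodClosed V) (T : submodClosed W).
Hypothesis fST : {in S, forall x, f x \in T}.

Definition submod_map (x : submod S) : submod T := Submod (fST (submod_valP x)).

Fact submod_map_linear : linear submod_map.
Proof. by move=> a x y; apply: val_inj; rewrite /= !linearP. Qed.
HB.instance Definition _ := GRing.isLinear.Build R (submod S) (submod T) _
  submod_map submod_map_linear.

Definition quotmod_fun (q : quotmod S) : quotmod T := pi_mod T (f (repr q)).

Lemma quotmod_funE x : quotmod_fun (pi_mod S x) = pi_mod T (f x).
Proof.
apply/pi_modP; rewrite -linearB fST //.
by apply/pi_modP; rewrite pi_mod_repr.
Qed.

Fact quotmod_fun_linear : linear quotmod_fun.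
Proof.
move=> a p q; rewrite -(pi_mod_repr q) -(pi_mod_repr p) -linearP.
by rewrite !quotmod_funE !linearP.
Qed.

Definition quotmod_map : {linear quotmod S -> quotmod T} :=
  HB.pack quotmod_fun
    (GRing.isLinear.Build R (quotmod S) (quotmod T) _ quotmod_fun quotmod_fun_linear).

Lemma quotmod_mapE x : quotmod_map (pi_mod S x) = pi_mod T (f x).
Proof. exact: quotmod_funE. Qed.

End Induced.

Section Free.
Variables (R : pzRingType) (K : choiceType).

Definition finsupp : {pred K -> R^o} :=
  [pred f : K -> R^o | `[< finite_set [set k | f k != 0] >]].

Lemma finsuppP f : reflect (finite_set [set k | f k != 0]) (f \in finsupp).
Proof. exact: asboolP. Qed.

Lemma finsupp_closed : submod_closed finsupp.
Proof.
split=> [|a f g].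
  apply/finsuppP; apply: (sub_finite_set _ (finite_set0 K)) => k /=.
  by rewrite eqxx.
move=> /finsuppP ff /finsuppP fg; apply/finsuppP.
have := conj ff fg; rewrite -finite_setU; apply: sub_finite_set => k /=.
have [f0|] := eqVneq (f k) 0; last by left.
have [g0|] := eqVneq (g k) 0; last by right.
by rewrite !fctE f0 g0 scaler0 addr0 eqxx.
Qed.

HB.instance Definition _ :=
  GRing.isSubmodClosed.Build R (K -> R^o) finsupp finsupp_closed.

Definition free := submod finsupp.
HB.instance Definition _ := GRing.Lmodule.on free.

Definition coeff (f : free) : K -> R := submod_val f.

Lemma finite_coeff f : finite_set [set k | coeff f k != 0].
Proof. exact/finsuppP/submod_valP. Qed.

Lemma coeff_inj f g : coeff f =1 coeff g -> f = g.
Proof. by move=> fg; apply: val_inj; apply/funext. Qed.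

Lemma coeffP a f g k : coeff (a *: f + g) k = a * coeff f k + coeff g k.
Proof. by rewrite /coeff linearP. Qed.

Fact delta_finsupp (k : K) : (fun j => (j == k)%:R : R^o) \in finsupp.
Proof.
apply/finsuppP; apply: (sub_finite_set _ (finite_set1 k)) => j /=.
by have [|] := eqVneq j k => [//|_]; rewrite eqxx.
Qed.

Definition delta (k : K) : free := Submod (delta_finsupp k).

Variables (M : lmodType R) (g : K -> M).

Definition lift (f : free) : M := \sum_(k \in [set: K]) coeff f k *: g k.

Lemma lift_supp (f : free) (A : set K) : finite_set A ->
  (forall k, coeff f k != 0 -> A k) ->
  lift f = \sum_(k \in A) coeff f k *: g k.
Proof.
move=> finA sA; apply/esym; apply: fsbig_widen => // k [_ /= nAk].
have [->|/sA//] := eqVneq (coeff f k) 0; exact: scale0r.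
Qed.

Fact lift_linear : linear lift.
Proof.
move=> a f h.
have := conj (finite_coeff f) (finite_coeff h); rewrite -finite_setU => fin.
rewrite (lift_supp (f := f) fin) //; last by move=> k; left.
rewrite (lift_supp (f := h) fin) //; last by move=> k; right.
rewrite (lift_supp (f := a *: f + h) fin); last first.
  move=> k; rewrite coeffP /=; have [->|] := eqVneq (coeff f k) 0; last by left.
  by rewrite mulr0 add0r; right.
rewrite !fsbig_finite //= scaler_sumr -big_split /=.
by apply: eq_bigr => k _; rewrite scalerA -scalerDl.
Qed.
HB.instance Definition _ := GRing.isLinear.Build R free M _ lift lift_linear.

Lemma lift_delta k : lift (delta k) = g k.
Proof.
rewrite (lift_supp (finite_set1 k)) ?fsbig_set1 /coeff /= ?eqxx ?scale1r // => j.
by rewrite /coeff /=; have [|] := eqVneq j k => [//|_]; rewrite eqxx.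
Qed.

End Free.

Section FreeExt.
Variables (R : pzRingType) (K : choiceType).

Lemma free_ext (M : lmodType R) (u v : {linear free R K -> M}) :
  (forall k, u (delta R k) = v (delta R k)) -> u =1 v.
Proof.
move=> uv f.
have -> : f = \sum_(k <- fset_set [set k | coeff f k != 0]) coeff f k *: delta R k.
  apply: coeff_inj => k; rewrite {2}/coeff raddf_sum fct_sumE /=.
  rewrite [RHS](eq_bigr (fun i => coeff f i * (k == i)%:R)) //.
  have [fk0|fk] := eqVneq (coeff f k) 0.
    rewrite big_seq big1 // => j _.
    by have [<-|_] := eqVneq k j; rewrite ?fk0 ?mul0r ?mulr0.
  rewrite (big_fsetD1 k) /=; last by rewrite in_fset_set ?inE //; exact: finite_coeff.
  rewrite eqxx mulr1 big_seq big1 ?addr0 // => j.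
  by rewrite !inE eq_sym => /andP[/negPf -> _]; rewrite mulr0.
by rewrite !linear_sum; apply: eq_bigr => k _; rewrite !linearZ uv.
Qed.

End FreeExt.

(** [resol M i] is the free module on (the underlying set of) the [i]-th syzygy
    of [M]; [... -> resol M 1 -> resol M 0 -> M -> 0] is a free resolution of
    [M], strictly functorial in [M]. *)

Section Resolution.
Variable R : pzRingType.
Implicit Types M N P : lmodType R.

Definition free_map (K K' : choiceType) (h : K -> K') :
  {linear free R K -> free R K'} := lift (fun k => delta R (h k)).

Definition cover M : {linear free R M -> M} := lift (@id M).

Definition syz M : lmodType R := submod (ker (cover M)).

Fixpoint syzygy i M : lmodType R := if i is j.+1 then syz (syzygy j M) else M.

Definition resol M i : lmodType R := free R (syzygy i M).

Definition diff M i : {linear resol M i.+1 -> resol M i} :=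
  @submod_val _ _ (ker (cover (syzygy i M))) \o cover (syzygy i.+1 M).

Lemma free_mapE (K K' : choiceType) (h : K -> K') k :
  free_map h (delta R k) = delta R (h k).
Proof. exact: lift_delta. Qed.

Lemma cover_delta M x : cover M (delta R x) = x.
Proof. exact: lift_delta. Qed.

Lemma cover_map M N (f : {linear M -> N}) x : cover N (free_map f x) = f (cover M x).
Proof.
apply: (free_ext (u := cover N \o free_map f) (v := f \o cover M)) => k /=.
by rewrite free_mapE !cover_delta.
Qed.

Fact free_map_ker M N (f : {linear M -> N}) :
  {in ker (cover M), forall x, free_map f x \in ker (cover N)}.
Proof. by move=> x /kerP x0; apply/kerP; rewrite cover_map x0 linear0. Qed.

Definition syz_map M N (f : {linear M -> N}) : {linear syz M -> syz N} :=
  submod_map (free_map_ker f).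

Fixpoint syzygy_map i M N (f : {linear M -> N}) :
    {linear syzygy i M -> syzygy i N} :=
  if i is j.+1 then syz_map (syzygy_map j f) else f.

Definition resol_map M N (f : {linear M -> N}) i :
  {linear resol M i -> resol N i} := free_map (syzygy_map i f).

Lemma resol_map_diff M N (f : {linear M -> N}) i x :
  diff N i (resol_map f i.+1 x) = resol_map f i (diff M i x).
Proof. by rewrite /diff /= cover_map. Qed.

Lemma syzygy_map_id M (f : {linear M -> M}) i :
  f =1 id -> syzygy_map i f =1 id.
Proof.
move=> fid; elim: i => [|i IH] //= x; apply: val_inj => /=.
by apply: (free_ext (v := idfun)) => k /=; rewrite free_mapE IH.
Qed.

Lemma resol_map_id M (f : {linear M -> M}) i : f =1 id -> resol_map f i =1 id.
Proof.
move=> fid; apply: (free_ext (v := idfun)) => k /=.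
by rewrite free_mapE syzygy_map_id.
Qed.

Lemma syzygy_map_comp M N P (f : {linear M -> N}) (g : {linear N -> P})
    (h : {linear M -> P}) i :
  h =1 g \o f -> syzygy_map i h =1 syzygy_map i g \o syzygy_map i f.
Proof.
move=> hgf; elim: i => [|i IH] //= x; apply: val_inj => /=.
apply: (free_ext (v := free_map (syzygy_map i g) \o free_map (syzygy_map i f))).
by move=> k /=; rewrite !free_mapE IH.
Qed.

Lemma resol_map_comp M N P (f : {linear M -> N}) (g : {linear N -> P})
    (h : {linear M -> P}) i :
  h =1 g \o f -> resol_map h i =1 resol_map g i \o resol_map f i.
Proof.
move=> hgf; apply: (free_ext (v := resol_map g i \o resol_map f i)) => k /=.
by rewrite !free_mapE (syzygy_map_comp hgf).
Qed.

End Resolution.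

(** [bimod A B] is the type of left [A]-modules with a commuting left
    [B]-module structure.  A [Lambda]-[Gamma]-bimodule in the usual sense (left
    over [Lambda], right over [Gamma]) is a [bimod Lambda (opring Gamma)]; this
    presentation makes the two sides interchangeable through [flip]. *)

Record bimod (A B : pzRingType) := Bimod {
  bimod_left :> lmodType A;
  bimod_act : B -> bimod_left -> bimod_left;
  bimod_actA : forall a b u, bimod_act a (bimod_act b u) = bimod_act (a * b) u;
  bimod_act1 : left_id 1 bimod_act;
  bimod_actDr : right_distributive bimod_act +%R;
  bimod_actDl : forall u, {morph bimod_act^~ u : a b / a + b};
  bimod_actC : forall a b u, bimod_act b (a *: u) = a *: bimod_act b u
}.

Notation bimodule Lambda Gamma := (bimod Lambda (opring Gamma)).

Definition rside (A B : pzRingType) (U : bimod A B) : Type := bimod_left U.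
HB.instance Definition _ A B (U : bimod A B) := GRing.Zmodule.on (rside U).
HB.instance Definition _ A B (U : bimod A B) :=
  GRing.Zmodule_isLmodule.Build B (rside U)
    (@bimod_actA A B U) (@bimod_act1 A B U) (@bimod_actDr A B U)
    (@bimod_actDl A B U).

Section Flip.
Variables (A B : pzRingType) (U : bimod A B).

Fact flip_actC a b (u : rside U) :
  b *: ((a *: (u : bimod_left U)) : rside U) = (a *: ((b *: u : rside U) : bimod_left U)).
Proof. exact: bimod_actC. Qed.

Definition flip : bimod B A :=
  @Bimod B A (rside U) (fun a u => a *: (u : bimod_left U))
    (@scalerA A U) (@scale1r A U) (@scalerDr A U) (@scalerDl A U)
    (fun b a u => esym (flip_actC a b u)).

Fact bimod_act_linear b : linear (@bimod_act A B U b).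
Proof. by move=> a u v; rewrite bimod_actDr bimod_actC. Qed.
HB.instance Definition _ b := GRing.isLinear.Build A U U _
  (@bimod_act A B U b) (bimod_act_linear b).

(** The natural map from [B] to the endomorphisms of the left [A]-module [U]. *)
Definition homothety (b : B) : {linear U -> U} := @bimod_act A B U b.

End Flip.

Section Hom.
Variables (A B : pzRingType) (U : bimod A B).

Definition hom (M : lmodType A) : Type := {linear M -> U}.

Section HomStruct.
Variable M : lmodType A.
Implicit Types f g h : hom M.

HB.instance Definition _ := gen_eqMixin (hom M).
HB.instance Definition _ := gen_choiceMixin (hom M).

Lemma homP f g : (forall x, f x = g x) -> f = g.
Proof.
case: f => f [[af] [bf]]; case: g => g [[ag] [bg]] /= fg.
have E : f = g by apply/funext.
case: g / E ag bg {fg} => ag bg.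
by rewrite (Prop_irrelevance af ag) (Prop_irrelevance bf bg).
Qed.

Definition hom_add f g : hom M := f \+ g.
Definition hom_opp f : hom M := \- f.
Definition hom_zero : hom M := \0.
Definition hom_scale (b : B) f : hom M := homothety U b \o f.

Fact hom_addA : associative hom_add.
Proof. by move=> f g h; apply: homP => x /=; rewrite addrA. Qed.
Fact hom_addC : commutative hom_add.
Proof. by move=> f g; apply: homP => x /=; rewrite addrC. Qed.
Fact hom_add0 : left_id hom_zero hom_add.
Proof. by move=> f; apply: homP => x /=; rewrite add0r. Qed.
Fact hom_addN : left_inverse hom_zero hom_opp hom_add.
Proof. by move=> f; apply: homP => x /=; rewrite addNr. Qed.
HB.instance Definition _ :=
  GRing.isZmodule.Build (hom M) hom_addA hom_addC hom_add0 hom_addN.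

Fact hom_scaleA a b f : hom_scale a (hom_scale b f) = hom_scale (a * b) f.
Proof. by apply: homP => x /=; rewrite bimod_actA. Qed.
Fact hom_scale1 : left_id 1 hom_scale.
Proof. by move=> f; apply: homP => x /=; rewrite bimod_act1. Qed.
Fact hom_scaleDr : right_distributive hom_scale +%R.
Proof. by move=> b f g; apply: homP => x /=; rewrite bimod_actDr. Qed.
Fact hom_scaleDl f : {morph hom_scale^~ f : a b / a + b}.
Proof. by move=> a b; apply: homP => x /=; rewrite bimod_actDl. Qed.
HB.instance Definition _ := GRing.Zmodule_isLmodule.Build B (hom M)
  hom_scaleA hom_scale1 hom_scaleDr hom_scaleDl.

End HomStruct.

Definition precomp (M N : lmodType A) (f : {linear M -> N}) (h : hom N) : hom M :=
  (h : {linear N -> U}) \o f.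

Fact precomp_linear (M N : lmodType A) (f : {linear M -> N}) : linear (precomp f).
Proof. by move=> b g h; apply: homP. Qed.
HB.instance Definition _ (M N : lmodType A) (f : {linear M -> N}) :=
  GRing.isLinear.Build B (hom N) (hom M) _ (precomp f) (precomp_linear f).

End Hom.

Section Ext.
Variables (A B : pzRingType) (U : bimod A B).
Implicit Types M N P : lmodType A.

Definition codiff M i : {linear hom U (resol M i) -> hom U (resol M i.+1)} :=
  precomp (U := U) (diff M i).

Definition cocycles M i : lmodType B := submod (ker (codiff M i)).

(** The image of the incoming differential (which is zero in degree [0]). *)
Definition coboundary M i : {pred hom U (resol M i)} :=
  match i return {pred hom U (resol M i)} with
  | 0 => pred1 0
  | j.+1 => im (codiff M j)
  end.
Arguments coboundary M i : clear implicits.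

Fact coboundary_closed M i : submod_closed (coboundary M i).
Proof.
case: i => [|j]; last exact: im_closed.
have E h : (h \in coboundary M 0) = (h == 0) by [].
split=> [|b x y]; rewrite !E // => /eqP -> /eqP ->.
by rewrite scaler0 addr0.
Qed.
HB.instance Definition _ M i :=
  GRing.isSubmodClosed.Build B (hom U (resol M i)) (coboundary M i)
    (coboundary_closed M i).

Definition Ext i M : lmodType B :=
  quotmod (preim_sub (@submod_val _ _ (ker (codiff M i))) (coboundary M i)).

Section Map.
Variables (i : nat) (M N : lmodType A) (f : {linear M -> N}).

Definition hom_resol_map : {linear hom U (resol N i) -> hom U (resol M i)} :=
  precomp (U := U) (resol_map f i).

Fact hom_resol_map_ker :
  {in ker (codiff N i), forall h, hom_resol_map h \in ker (codiff M i)}.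
Proof.
move=> h /kerP hd; apply/kerP; apply: homP => x.
have /= := congr1 (fun k : hom U _ => k (resol_map f i.+1 x)) hd.
by rewrite /= -resol_map_diff.
Qed.

Definition cocycles_map : {linear cocycles N i -> cocycles M i} :=
  submod_map hom_resol_map_ker.

Fact hom_resol_map_boundary h :
  h \in coboundary N i -> hom_resol_map h \in coboundary M i.
Proof.
rewrite /hom_resol_map; case: i h => [|j] h.
  by move=> /eqP ->; rewrite linear0; apply/eqP.
move=> /imP[k <-]; apply/imP; exists (precomp (U := U) (resol_map f j) k).
by apply: homP => x; rewrite /= -resol_map_diff.
Qed.

Fact cocycles_map_boundary :
  {in preim_sub (@submod_val _ _ (ker (codiff N i))) (coboundary N i),
    forall h, cocycles_map h \in
      preim_sub (@submod_val _ _ (ker (codiff M i))) (coboundary M i)}.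
Proof. by move=> h; apply: hom_resol_map_boundary. Qed.

Definition Ext_map : {linear Ext i N -> Ext i M} := quotmod_map cocycles_map_boundary.

Lemma Ext_mapE z :
  Ext_map (pi_mod _ z) = pi_mod _ (cocycles_map z).
Proof. exact: quotmod_mapE. Qed.

End Map.

Lemma Ext_map_id i M (f : {linear M -> M}) : f =1 id -> Ext_map i f =1 id.
Proof.
move=> fid q; rewrite -(pi_mod_repr q) Ext_mapE.
congr (pi_mod _ _); apply: val_inj; apply: homP => x /=.
by rewrite resol_map_id.
Qed.

Lemma Ext_map_comp i M N P (f : {linear M -> N}) (g : {linear N -> P})
    (h : {linear M -> P}) :
  h =1 g \o f -> Ext_map i h =1 Ext_map i f \o Ext_map i g.
Proof.
move=> hgf q; rewrite -(pi_mod_repr q) /comp !Ext_mapE.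
congr (pi_mod _ _); apply: val_inj; apply: homP => x /=.
by rewrite (resol_map_comp hgf).
Qed.

End Ext.

(** Under [hom_Ext0], [Ext U 0] is identified with [hom U], as is customary. *)
Section Ext0.
Variables (A B : pzRingType) (U : bimod A B) (M : lmodType A).

Fact hom_cover_ker (h : hom U M) : precomp (U := U) (cover M) h \in ker (codiff U M 0).
Proof.
apply/kerP; apply: homP => x /=.
by rewrite (kerP _ _ (submod_valP _)) linear0.
Qed.

Definition hom_Ext0 (h : hom U M) : Ext U 0 M := pi_mod _ (Submod (hom_cover_ker h)).

Fact hom_Ext0_linear : linear hom_Ext0.
Proof.
move=> b h k; rewrite /hom_Ext0 -linearP; congr (pi_mod _ _).
by apply: val_inj; apply: homP.
Qed.
HB.instance Definition _ :=
  GRing.isLinear.Build B (hom U M) (Ext U 0 M) _ hom_Ext0 hom_Ext0_linear.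

Section Inverse.
Variable z : cocycles U M 0.

Let z_ker (x : free A M) : cover M x = 0 -> submod_val z x = 0.
Proof.
move=> /kerP x0.
have /= := congr1 (fun k : hom U _ => k (delta A (Submod x0 : syzygy 1 M)))
  (kerP _ _ (submod_valP z)).
by rewrite cover_delta.
Qed.

Definition Ext0_fun (m : M) : U := submod_val z (delta A m).

Fact Ext0_fun_linear : linear Ext0_fun.
Proof.
move=> a m n; apply/eqP; rewrite -subr_eq0 /Ext0_fun -linearP -linearB; apply/eqP.
by apply: z_ker; rewrite linearB linearP !cover_delta subrr.
Qed.
HB.instance Definition _ :=
  GRing.isLinear.Build A M U _ Ext0_fun Ext0_fun_linear.

Definition Ext0_hom : hom U M := Ext0_fun.

Lemma Ext0_homK : hom_Ext0 Ext0_hom = pi_mod _ z.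
Proof.
congr (pi_mod _ _); apply: val_inj; apply: homP => x.
apply: (free_ext (v := submod_val z)) => m /=.
by rewrite cover_delta.
Qed.

End Inverse.

Lemma hom_Ext0_bij : bijective hom_Ext0.
Proof.
exists (fun q => Ext0_hom (repr q)) => [h|q]; last first.
  by rewrite Ext0_homK pi_mod_repr.
have /pi_modP/eqP := pi_mod_repr (hom_Ext0 h).
rewrite linearB => /subr0_eq /= E; apply: homP => m; rewrite /= /Ext0_fun E /=.
by rewrite cover_delta.
Qed.

End Ext0.

Definition fingen (R : pzRingType) (M : lmodType R) : Prop :=
  exists (n : nat) (s : 'I_n -> M),
    forall x, exists a : 'I_n -> R, x = \sum_i a i *: s i.

Definition left_noetherian (R : pzRingType) : Prop :=
  forall I : submodClosed R^o, fingen (submod I).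

Definition right_noetherian (R : pzRingType) : Prop := left_noetherian (opring R).

Definition isomorphic (R : pzRingType) (M N : lmodType R) : Prop :=
  exists f : {linear M -> N}, bijective f.

Definition injective_module (R : pzRingType) (I : lmodType R) : Prop :=
  forall (M N : lmodType R) (i : {linear M -> N}) (f : {linear M -> I}),
    injective i -> exists g : {linear N -> I}, forall x, g (i x) = f x.

(** [M] has an injective resolution [0 -> M -> I 0 -> ... -> I n -> 0]. *)
Definition injdim_le (R : pzRingType) (M : lmodType R) (n : nat) : Prop :=
  exists (I : nat -> lmodType R) (e : {linear M -> I 0})
         (d : forall i, {linear I i -> I i.+1}),
    [/\ forall i, injective_module (I i),
        injective e,
        forall y, d 0 y = 0 <-> exists x, e x = y,
        forall i y, d i.+1 y = 0 <-> exists x, d i x = y &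
        forall i, (n < i)%N -> forall y : I i, y = 0].

Definition injdim_eq (R : pzRingType) (M : lmodType R) (n : nat) : Prop :=
  injdim_le M n /\ forall m, injdim_le M m -> (n <= m)%N.

Definition zero_module (R : pzRingType) (M : lmodType R) : Prop := forall x : M, x = 0.

Definition faithfully_balanced (A B : pzRingType) (U : bimod A B) : Prop :=
  bijective (homothety (flip U)) /\ bijective (homothety U).

Definition selforthogonal (A B : pzRingType) (U : bimod A B) : Prop :=
  forall i, (0 < i)%N ->
    zero_module (Ext U i U) /\ zero_module (Ext (flip U) i (flip U)).

Section Grade.
Variables (A B : pzRingType) (U : bimod A B).

Definition grade_ge (M : lmodType A) (i : nat) : Prop :=
  forall j, (j < i)%N -> zero_module (Ext U j M).

Definition grade_eq (M : lmodType A) (g : nat) : Prop :=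
  grade_ge M g /\ ~ grade_ge M g.+1.

Definition sgrade_ge (M : lmodType A) (i : nat) : Prop :=
  forall S : submodClosed M, grade_ge (submod S) i.

(** Membership in the full subcategory of finitely generated modules of grade [g]. *)
Definition has_grade (g : nat) (M : lmodType A) : Prop := fingen M /\ grade_eq M g.

End Grade.

Definition gorenstein (A B : pzRingType) (U : bimod A B) : Prop :=
  (forall (N : lmodType B) i, fingen N -> (0 < i)%N ->
     sgrade_ge U (Ext (flip U) i N) i) /\
  (forall (M : lmodType A) i, fingen M -> (0 < i)%N ->
     sgrade_ge (flip U) (Ext U i M) i).

Record fullsub (R : pzRingType) (P : lmodType R -> Prop) :=
  Fullsub { fullsub_obj :> lmodType R; fullsubP : P fullsub_obj }.

Record contrafunctor (R S : pzRingType) (P : lmodType R -> Prop)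
    (Q : lmodType S -> Prop) := Contrafunctor {
  fobj :> fullsub P -> fullsub Q;
  fmap : forall M N : fullsub P, {linear M -> N} -> {linear fobj N -> fobj M};
  fmap_id : forall (M : fullsub P) (f : {linear M -> M}),
    f =1 id -> fmap f =1 id;
  fmap_comp : forall (M N K : fullsub P) (f : {linear M -> N})
      (g : {linear N -> K}) (h : {linear M -> K}),
    h =1 g \o f -> fmap h =1 fmap f \o fmap g
}.

Definition comp_natiso_id (R S : pzRingType) (P : lmodType R -> Prop)
    (Q : lmodType S -> Prop) (F : contrafunctor P Q) (G : contrafunctor Q P) : Prop :=
  exists eta : forall M : fullsub P, {linear M -> G (F M)},
    (forall M, bijective (eta M)) /\
    forall (M N : fullsub P) (f : {linear M -> N}) x,
      eta N (f x) = fmap G (fmap F f) (eta M x).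

Definition is_duality (R S : pzRingType) (P : lmodType R -> Prop)
    (Q : lmodType S -> Prop) (F : contrafunctor P Q) : Prop :=
  exists G : contrafunctor Q P, comp_natiso_id F G /\ comp_natiso_id G F.

Definition Ext_functor (A B : pzRingType) (U : bimod A B) (g : nat)
    (P : lmodType A -> Prop) (Q : lmodType B -> Prop)
    (PQ : forall M, P M -> Q (Ext U g M)) : contrafunctor P Q :=
  @Contrafunctor A B P Q
    (fun M => Fullsub (PQ M (fullsubP M)))
    (fun M N f => Ext_map U g f)
    (fun M f => @Ext_map_id A B U g M f)
    (fun M N K f h k => @Ext_map_comp A B U g M N K f h k).

(* Main.v *)
(** Let [P] be a resolution of [M] by finite free modules, [E = Ext^g(M, U)] and
    [M^* = Hom(M, U)].  If [Ext^j(M, U) = 0] for [j < g], the complex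
      [0 -> P_0^* -> P_1^* -> ... -> P_g^* -> Y -> 0]
    is exact and [E] is the kernel of [Y -> P_(g+1)^*].  Since [P_i^{**} = P_i]
    and the [P_i^*] are [Ext(-, U)]-acyclic, dimension shifting along this
    complex gives [M = Ext^g(Y, U)] (for [g > 0]).  As [Y / E] embeds in [P_(g+1)^*] and [U]
    has injective dimension [<= g], [Ext^g] and [Ext^(g+1)] vanish on [Y / E], so
    [Ext^g(Y, U) = Ext^g(E, U)].  For [g = 0], [U] is injective and dualizing
    [0 -> E -> P_0^* -> P_1^*] gives [M = E^*].

    For [x] in [P_0], the class of [x] goes to that of the cocycle
    [F_g -> P_0^* -> U], where the first map is the last term of a lift of
    [E -> Y] to a map from the free resolution [F] of [E] to the complex above,
    and the second is evaluation at [x].  This is linear and natural in [M], as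
    lifts are unique up to homotopy; bijectivity is proved with a finite
    injective resolution of [U].  The Gorenstein condition is only needed to see
    that [E] has grade [g]. *)

Require Import Defs.
From HB Require Import structures.
From mathcomp Require Import all_boot all_order all_algebra.
From mathcomp Require Import boolp classical_sets functions.

Set Implicit Arguments.
Unset Strict Implicit.
Unset Printing Implicit Defensive.

(* Repeated because [all_boot] and [all_algebra] shadow [free] and [lift]. *)
Import Defs GRing.Theory.
Local Open Scope ring_scope.

(** * Factorization of linear maps, injectives and projectives *)

Section LinearMaps.
Variable R : pzRingType.
Implicit Types M N P : lmodType R.

Definition mk_linear M N (f : M -> N) (f_lin : linear f) : {linear M -> N} :=
  HB.pack f (GRing.isLinear.Build R M N _ f f_lin).

Lemma linear_ext M N (f g : {linear M -> N}) : f =1 g -> f = g.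
Proof.
case: f => f [[af] [bf]]; case: g => g [[ag] [bg]] /= /funext fg.
case: g / fg ag bg => ag bg.
by rewrite (Prop_irrelevance af ag) (Prop_irrelevance bf bg).
Qed.

Lemma linear_factor_surj M N P (p : {linear M -> N}) (f : {linear M -> P}) :
    (forall y, exists x, p x = y) -> (forall x, p x = 0 -> f x = 0) ->
  exists h : {linear N -> P}, forall x, h (p x) = f x.
Proof.
move=> /choice[s sK] ker_pf.
have fE x y : p x = p y -> f x = f y.
  by move=> E; apply/subr0_eq; rewrite -linearB ker_pf // linearB E subrr.
have f_lin : linear (fun y => f (s y)).
  by move=> a y z; rewrite -linearP; apply: fE; rewrite linearP !sK.
by exists (mk_linear f_lin) => x /=; apply: fE; rewrite sK.
Qed.

Lemma linear_factor_inj M N P (i : {linear M -> N}) (f : {linear P -> N}) :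
    (forall x, i x = 0 -> x = 0) -> (forall x, exists y, i y = f x) ->
  exists h : {linear P -> M}, forall x, i (h x) = f x.
Proof.
move=> i_inj /choice[s sE].
have s_lin : linear s.
  move=> a x y; apply/subr0_eq/i_inj.
  by rewrite linearB linearP !sE linearP subrr.
by exists (mk_linear s_lin) => x /=.
Qed.

(** As [f] kills the kernel of [i], it descends to the image of [i], whose inclusion is
    injective. *)
Lemma injective_module_extend M N (I : lmodType R) (i : {linear M -> N})
    (f : {linear M -> I}) :
  injective_module I -> (forall x, i x = 0 -> f x = 0) ->
  exists g : {linear N -> I}, forall x, g (i x) = f x.
Proof.
move=> I_inj ker_if.
have im_i x : i x \in im i by apply/imP; exists x.
have j_lin : linear (fun x => Submod (im_i x) : submod (im i)).
  by move=> a x y; apply: val_inj; rewrite /= linearP.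
have [||h hE] := linear_factor_surj (p := mk_linear j_lin) (f := f).
- case=> y y_im; have [x xy] := imP _ _ y_im.
  by exists x; apply: val_inj.
- by move=> x /(congr1 (@submod_val _ _ _)) /= /ker_if.
have [g gE] := I_inj _ _ (@submod_val _ _ (im i)) h val_inj.
by exists g => x; rewrite -(hE x) -gE.
Qed.

(** Only the image of [f] has to be hit by [p], so exactness of a complex can be fed in directly. *)
Definition projective P := forall M N (p : {linear M -> N}) (f : {linear P -> N}),
  (forall x, exists y, p y = f x) -> exists h : {linear P -> M}, forall x, p (h x) = f x.

Lemma free_projective (K : choiceType) : projective (free R K).
Proof.
move=> M N p f /choice[s sE].
exists (lift (fun k => s (delta R k))) => x.
apply: (free_ext (u := p \o lift (fun k => s (delta R k)))) => k /=.
by rewrite lift_delta sE.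
Qed.

End LinearMaps.

(** [G] is the invariant that makes the next choice possible. Chain maps and homotopies are built
    this way, degree by degree. *)
Lemma dependent_choice (T : nat -> Type) (G : forall i, T i -> Prop)
    (S : forall i, T i -> T i.+1 -> Prop) :
    (exists x, G 0%N x) ->
    (forall i x, G i x -> exists y, S i x y /\ G i.+1 y) ->
  exists s : forall i, T i, G 0%N (s 0%N) /\ forall i, S i (s i) (s i.+1).
Proof.
move=> /cid G0 GS.
pose next i (x : {x : T i | G i x}) : {y : T i.+1 | G i.+1 y} :=
  let y := cid (GS i (sval x) (svalP x)) in exist _ (sval y) (svalP y).2.
pose s := fix s i : {x : T i | G i x} :=
  if i is j.+1 then next j (s j) else G0.
exists (fun i => sval (s i)); split=> [|i]; first exact: svalP (s 0%N).
exact: (svalP (cid (GS i (sval (s i)) (svalP (s i))))).1.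
Qed.

(** * Resolutions and cohomology *)

Section Resolutions.
Variable R : pzRingType.
Implicit Types M N : lmodType R.

Record resolution M := Resolution {
  res_term :> nat -> lmodType R;
  res_diff : forall i, {linear res_term i.+1 -> res_term i};
  res_aug : {linear res_term 0%N -> M};
  res_aug_surj : forall y, exists x, res_aug x = y;
  res_exact0 : forall x, res_aug x = 0 <-> exists y, res_diff 0 y = x;
  res_exact : forall i x, res_diff i x = 0 <-> exists y, res_diff i.+1 y = x;
  res_projective : forall i, projective (res_term i)
}.

Definition chain_map M N (C : resolution M) (D : resolution N) (f : M -> N)
    (u : forall i, {linear C i -> D i}) :=
  (forall x, res_aug D (u 0%N x) = f (res_aug C x)) /\
  (forall i x, res_diff D i (u i.+1 x) = u i (res_diff C i x)).

Lemma res_diff0 M (C : resolution M) x : res_aug C (res_diff C 0 x) = 0.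
Proof. by apply/res_exact0; exists x. Qed.

Lemma res_diff_diff M (C : resolution M) i x : res_diff C i (res_diff C i.+1 x) = 0.
Proof. by apply/res_exact; exists x. Qed.

Lemma chain_map_exists M N (C : resolution M) (D : resolution N)
    (f : {linear M -> N}) : exists u, chain_map (C := C) (D := D) f u.
Proof.
(* Besides the augmentation condition in degree 0, the invariant says that [u] carries boundaries to
   boundaries, as the next lifting requires. *)
pose G i (u : {linear C i -> D i}) :=
  (match i return {linear C i -> D i} -> Prop with
    | 0 => fun u => forall x, res_aug D (u x) = f (res_aug C x)
    | _ => fun _ => True
    end) u /\
  forall x, exists y, res_diff D i y = u (res_diff C i x).
pose S i (u : {linear C i -> D i}) (v : {linear C i.+1 -> D i.+1}) :=
  forall x, res_diff D i (v x) = u (res_diff C i x).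
have [||u [[u0 _] uS]] := dependent_choice (G := G) (S := S).
- have [|u uE] := @res_projective _ C 0 _ _ (res_aug D) (f \o res_aug C).
    by move=> x; apply: res_aug_surj.
  exists u; split=> // x; apply/res_exact0.
  by rewrite uE /= res_diff0 linear0.
- move=> i u [_ uG].
  have [|v vE] := @res_projective _ C i.+1 _ _ (res_diff D i) (u \o res_diff C i).
    exact: uG.
  exists v; split=> //; split=> // x; apply/res_exact.
  by rewrite vE /= res_diff_diff linear0.
by exists u.
Qed.

Lemma null_homotopy M N (C : resolution M) (D : resolution N)
    (w : forall i, {linear C i -> D i}) : chain_map (C := C) (D := D) (fun=> 0) w ->
  exists s : forall i, {linear C i -> D i.+1},
    (forall x, w 0%N x = res_diff D 0 (s 0%N x)) /\
    (forall i x, w i.+1 x = res_diff D i.+1 (s i.+1 x) + s i (res_diff C i x)).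
Proof.
move=> [w0 wS].
pose G i (s : {linear C i -> D i.+1}) :=
  (match i return {linear C i -> D i.+1} -> Prop with
    | 0 => fun s => forall x, w 0%N x = res_diff D 0 (s x)
    | _ => fun _ => True
    end) s /\
  forall x, res_diff D i (w i.+1 x - s (res_diff C i x)) = 0.
pose S i (s : {linear C i -> D i.+1}) (t : {linear C i.+1 -> D i.+2}) :=
  forall x, w i.+1 x = res_diff D i.+1 (t x) + s (res_diff C i x).
have [||s [[s0 _] sS]] := dependent_choice (G := G) (S := S).
- have [|s sE] := @res_projective _ C 0 _ _ (res_diff D 0) (w 0%N).
    by move=> x; apply/res_exact0; rewrite w0.
  exists s; split=> // x.
  by rewrite linearB wS sE subrr.
- move=> i s [_ sG].
  have [|t tE] := @res_projective _ C i.+1 _ _ (res_diff D i.+1)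
      (w i.+1 \- (s \o res_diff C i)).
    by move=> x; apply/res_exact/sG.
  have tS : S i s t by move=> x; rewrite tE /= subrK.
  exists t; split=> //; split=> // x.
  by rewrite linearB wS tS res_diff_diff linear0 addr0 subrr.
by exists s.
Qed.

Lemma chain_map_comp M N P (C : resolution M) (D : resolution N) (E : resolution P)
    f g u v : chain_map (C := C) (D := D) f u -> chain_map (C := D) (D := E) g v ->
  chain_map (C := C) (D := E) (g \o f) (fun i => v i \o u i).
Proof.
move=> [u0 uS] [v0 vS]; split=> [x|i x] /=; first by rewrite v0 u0.
by rewrite vS uS.
Qed.

Lemma chain_map_sub M N (C : resolution M) (D : resolution N)
    f g u v : chain_map (C := C) (D := D) f u -> chain_map (C := C) (D := D) g v ->
    f =1 g ->
  chain_map (C := C) (D := D) (fun=> 0) (fun i => u i \- v i).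
Proof.
move=> [u0 uS] [v0 vS] fg; split=> [x|i x] /=; first by rewrite linearB u0 v0 fg subrr.
by rewrite linearB uS vS.
Qed.

Lemma chain_map_id M (C : resolution M) : chain_map (C := C) (D := C) id (fun=> idfun).
Proof. by split. Qed.

Lemma cover_surj M y : exists x, cover M x = y.
Proof. by exists (delta R y); apply: cover_delta. Qed.

Lemma syz_im M i x : (exists y, diff M i y = x) <-> cover (syzygy i M) x = 0.
Proof.
split=> [[y <-]|/kerP x0]; first exact/kerP/submod_valP.
by exists (delta R (Submod x0 : syzygy i.+1 M)); rewrite /diff /= cover_delta.
Qed.

(** Transparent, because its [cob] is later identified with [coboundary] by conversion. *)
Definition std_resolution M : resolution M.
Proof.
refine (@Resolution M (resol M) (diff M) (cover M) (@cover_surj M) _ _ _).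
- by move=> x; apply: iff_sym; exact: (@syz_im M 0 x).
- move=> i x; apply: iff_trans (iff_sym (@syz_im M i.+1 x)).
  split=> [|E]; last by rewrite /diff /= E.
  by move=> E; apply: val_inj; rewrite /= -/(syzygy _ _) in E *; exact: E.
- by move=> i; apply: free_projective.
Defined.

Lemma std_chain_map M N (f : {linear M -> N}) :
  chain_map (C := std_resolution M) (D := std_resolution N) f (resol_map f).
Proof.
split=> [x|i x]; first exact: cover_map.
exact: resol_map_diff.
Qed.

End Resolutions.

Section Cohomology.
Variables (A B : pzRingType) (U : bimod A B).
Implicit Types M N : lmodType A.

Definition res_codiff M (C : resolution M) i :
  {linear hom U (C i) -> hom U (C i.+1)} := precomp (U := U) (res_diff C i).

Definition cob M (C : resolution M) i : {pred hom U (C i)} :=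
  match i return {pred hom U (C i)} with
  | 0 => pred1 0
  | j.+1 => im (res_codiff C j)
  end.
Arguments cob M C i : clear implicits.

Fact cob_closed M (C : resolution M) i : submod_closed (cob M C i).
Proof.
case: i => [|j]; last exact: im_closed.
have E h : (h \in cob M C 0) = (h == 0) by [].
split=> [|b x y]; rewrite !E // => /eqP -> /eqP ->.
by rewrite scaler0 addr0.
Qed.
HB.instance Definition _ M (C : resolution M) i :=
  GRing.isSubmodClosed.Build B (hom U (C i)) (cob M C i) (cob_closed C i).

Lemma cob_precomp M N (C : resolution M) (D : resolution N) f u i z :
    chain_map (C := C) (D := D) f u -> z \in cob N D i ->
  precomp (U := U) (u i) z \in cob M C i.
Proof.
move=> [_ uS]; case: i z => [|i] z.
  by move=> /eqP ->; apply/eqP; rewrite linear0.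
move=> /imP[y <-]; apply/imP; exists (precomp (U := U) (u i) y).
by apply: homP => x /=; rewrite uS.
Qed.

(** If [w = d s + s d] and [z d = 0], then [z w = (z s) d]; in degree 0 nothing is left. *)
Lemma cob_null M N (C : resolution M) (D : resolution N) w i (z : hom U (D i)) :
    chain_map (C := C) (D := D) (fun=> 0) w -> res_codiff D i z = 0 ->
  precomp (U := U) (w i) z \in cob M C i.
Proof.
move=> /null_homotopy[s [s0 sS]] z0.
have {}z0 x : z (res_diff D i x) = 0 := congr1 (fun h : hom U _ => h x) z0.
case: i z z0 => [|i] z z0.
  by apply/eqP; apply: (@homP _ _ U (C 0%N)) => x /=; rewrite s0 z0.
apply/imP; exists (precomp (U := U) (s i) z); apply: homP => x /=.
by rewrite sS linearD z0 add0r.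
Qed.

Lemma cob_homotopic M N (C : resolution M) (D : resolution N) f g u v i
    (z : hom U (D i)) :
    chain_map (C := C) (D := D) f u -> chain_map (C := C) (D := D) g v -> f =1 g ->
    res_codiff D i z = 0 ->
  precomp (U := U) (u i) z - precomp (U := U) (v i) z \in cob M C i.
Proof.
move=> uC vC fg z0; have /= := cob_null (chain_map_sub uC vC fg) z0.
suff -> : precomp (U := U) (u i) z - precomp (U := U) (v i) z =
          precomp (U := U) (u i \- v i) z by [].
by apply: homP => x /=; rewrite linearB.
Qed.

Lemma cocycle_precomp M N (C : resolution M) (D : resolution N) f u i
    (z : hom U (D i)) :
  chain_map (C := C) (D := D) f u -> res_codiff D i z = 0 ->
  res_codiff C i (precomp (U := U) (u i) z) = 0.
Proof.
move=> [_ uS] z0; apply: homP => x /=; rewrite -uS.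
exact: (congr1 (fun h : hom U _ => h (u i.+1 x)) z0).
Qed.

End Cohomology.
Arguments cob {A B} U {M} C i.
Arguments res_codiff {A B} U {M} C i.

(** * Noetherian modules *)

Section Noetherian.
Variable R : pzRingType.
Implicit Types M N V W : lmodType R.

Definition noetherian_module M := forall S : submodClosed M, fingen (submod S).

Lemma fingen_surj M N (p : {linear M -> N}) :
  (forall y, exists x, p x = y) -> fingen M -> fingen N.
Proof.
move=> p_surj [n [s sE]]; exists n, (p \o s) => y.
have [x <-] := p_surj y; have [a ->] := sE x; exists a.
by rewrite linear_sum; apply: eq_bigr => i _; rewrite linearZ.
Qed.

Lemma noetherian_module_surj V W (p : {linear V -> W}) :
  (forall y, exists x, p x = y) -> noetherian_module V -> noetherian_module W.
Proof.
move=> p_surj V_noeth S.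
have pS : {in preim_sub p S, forall x, p x \in S} by [].
apply: (fingen_surj (p := submod_map pS)) (V_noeth (preim_sub p S)).
case=> y yS; have [x xy] := p_surj y.
have xS : x \in preim_sub p S by rewrite inE /= xy.
by exists (Submod xS); apply: val_inj.
Qed.

(** [S] is generated by preimages of generators of [p(S)] together with generators of its
    intersection with the kernel. *)
Lemma noetherian_module_ext V W (p : {linear V -> W}) :
  noetherian_module (submod (ker p)) -> noetherian_module W -> noetherian_module V.
Proof.
move=> K_noeth W_noeth S.
pose pS : {linear submod S -> W} := p \o @submod_val _ _ S.
pose KS := preim_sub (@submod_val _ _ (ker p)) S.
have [m [t tE]] := W_noeth (im pS); have [n [k kE]] := K_noeth KS.
have /choice[s sE] i : exists x : submod S, pS x = submod_val (t i).
  exact: (imP _ _ (submod_valP (t i))).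
pose l j : submod S := Submod (submod_valP (k j) : submod_val (submod_val (k j)) \in S).
exists (m + n)%N.
exists (fun i => match fintype.split i with inl j => s j | inr j => l j end) => x.
have px : pS x \in im pS by apply/imP; exists x.
have [a aE] := tE (Submod px).
pose y := x - \sum_i a i *: s i.
have y0 : submod_val y \in ker p.
  apply/kerP; rewrite -[LHS]/(pS y) linearB linear_sum.
  have -> : pS x = \sum_i a i *: submod_val (t i).
    have /= -> := congr1 (@submod_val _ _ _) aE.
    by rewrite linear_sum; apply: eq_bigr => i _; rewrite linearZ.
  apply/eqP; rewrite subr_eq0; apply/eqP; apply: eq_bigr => i _.
  by rewrite linearZ /= -sE.
have [b bE] := kE (Submod (submod_valP y : Submod y0 \in KS)).
exists (fun i => match fintype.split i with inl j => a j | inr j => b j end).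
rewrite big_split_ord /=.
under eq_bigr => i _ do rewrite -[lshift n i]/(unsplit (inl i)) unsplitK.
under [X in _ + X]eq_bigr => i _ do rewrite -[rshift m i]/(unsplit (inr i)) unsplitK.
apply/eqP; rewrite addrC -subr_eq -/y; apply/eqP/val_inj => /=.
have := congr1 (fun z => submod_val (submod_val z)) bE; rewrite /= => ->.
by rewrite !linear_sum; apply: eq_bigr => i _; rewrite !linearZ.
Qed.

Hypothesis R_noeth : left_noetherian R.

(** Induction on the number of generators: the first one spans a quotient of [R], and modulo it one
    generator fewer suffices. *)
Lemma noetherian_fingen M : fingen M -> noetherian_module M.
Proof.
move=> [n]; elim: n M => [|n IHn] M [s sE].
  move=> S; exists 0%N, (fun=> 0) => x; exists (fun=> 0); apply: val_inj => /=.
  by have [a /= ->] := sE (submod_val x); rewrite !big_ord0.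
have s0_lin : linear (fun a : R^o => (a : R) *: s ord0).
  by move=> a b c; rewrite scalerDl scalerA.
pose f := mk_linear s0_lin.
pose p : {linear M -> quotmod (im f)} := @pi_mod _ _ (im f).
apply: (noetherian_module_ext (p := p)).
  have fK (a : R^o) : f a \in ker p.
    apply/kerP; rewrite -(linear0 p); apply/pi_modP; rewrite subr0.
    by apply/imP; exists a.
  have g_lin : linear (fun a => Submod (fK a)).
    by move=> a x y; apply: val_inj; rewrite /= scalerDl scalerA.
  apply: (noetherian_module_surj (p := mk_linear g_lin)) R_noeth.
  case=> x xK; have /kerP := xK; rewrite -(linear0 p) => /pi_modP.
  rewrite subr0 => /imP[a ax]; exists a; exact: val_inj.
apply: IHn; exists (fun i => p (s (fintype.lift ord0 i))) => q.
have [a aE] := sE (repr q); exists (a \o fintype.lift ord0).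
rewrite -(pi_mod_repr q) aE big_ord_recl -/(p _) linearD linear_sum.
have -> : p (a ord0 *: s ord0) = 0.
  rewrite -(linear0 p); apply/pi_modP; rewrite subr0.
  by apply/imP; exists (a ord0).
by rewrite add0r; apply: eq_bigr => i _; rewrite linearZ.
Qed.

Lemma fingen_inj M N (i : {linear N -> M}) :
  (forall x, i x = 0 -> x = 0) -> fingen M -> fingen N.
Proof.
move=> i_inj /noetherian_fingen M_noeth.
have [h hE] := linear_factor_inj i_inj (f := @submod_val _ _ (im i))
  (fun x => imP _ _ (submod_valP x)).
apply: (fingen_surj (p := h)) (M_noeth (im i)) => y.
have yi : i y \in im i by apply/imP; exists y.
by exists (Submod yi); apply/subr0_eq/i_inj; rewrite linearB hE subrr.
Qed.

Lemma fingen_cover M : fingen M ->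
  exists n (p : {linear free R 'I_n -> M}), forall y, exists x, p x = y.
Proof.
move=> [n [s sE]]; exists n, (lift s) => y.
have [a ->] := sE y; exists (\sum_i a i *: delta R i).
by rewrite linear_sum; apply: eq_bigr => i _; rewrite linearZ /= lift_delta.
Qed.

Lemma free_fin_sum n (x : free R 'I_n) : x = \sum_i coeff x i *: delta R i.
Proof.
apply: coeff_inj => k.
rewrite [RHS]/coeff raddf_sum fct_sumE /= (bigD1 k) //= big1 => [|i ik].
  by rewrite addr0 -[RHS]/(coeff x k * (k == k)%:R) eqxx mulr1.
by rewrite -[LHS]/(coeff x i * (k == i)%:R) eq_sym (negPf ik) mulr0.
Qed.

Lemma fingen_free n : fingen (free R 'I_n).
Proof.
by exists n, (@delta R 'I_n) => x; exists (coeff x); apply: free_fin_sum.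
Qed.

(** An equality rather than an isomorphism, so that a term of a resolution can be replaced by
    rewriting. *)
Definition finite_free M := exists n, M = free R 'I_n.

Lemma finite_free_resolution M : fingen M ->
  exists C : resolution M, forall i, finite_free (C i).
Proof.
move=> M_fg.
(* Finite generation is carried along with the module, so that the syzygies can be defined by
   recursion. *)
pose cov (Z : {N : lmodType R | fingen N}) := cid (fingen_cover (svalP Z)).
pose rk Z := sval (cov Z).
pose p Z : {linear free R 'I_(rk Z) -> sval Z} := sval (cid (svalP (cov Z))).
have p_surj Z : forall y, exists x, p Z x = y := svalP (cid (svalP (cov Z))).
pose next Z : {N : lmodType R | fingen N} :=
  exist _ (submod (ker (p Z)) : lmodType R)
    (noetherian_fingen (fingen_free _) (ker (p Z))).
pose Z := fix Z i := if i is j.+1 then next (Z j) else exist _ M M_fg.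
pose C i : lmodType R := free R 'I_(rk (Z i)).
pose d i : {linear C i.+1 -> C i} := @submod_val _ _ (ker (p (Z i))) \o p (Z i.+1).
have im_d i x : (exists y, d i y = x) <-> p (Z i) x = 0.
  split=> [[y <-]|/kerP x0]; first exact/kerP/submod_valP.
  have [y yE] := p_surj (Z i.+1) (Submod x0).
  by exists y; rewrite /d /= yE.
unshelve eexists (@Resolution _ M C d (p (Z 0%N)) (p_surj (Z 0%N)) _ _ _).
- by move=> x; apply: iff_sym; apply: im_d.
- move=> i x; apply: iff_trans (iff_sym (im_d i.+1 x)).
  by split=> E; [apply: val_inj | rewrite /d /= E].
- by move=> i; apply: free_projective.
by move=> i; exists (rk (Z i)).
Qed.

End Noetherian.

(** * Lifting along exact complexes *)

Section Extendable.
Variables (R : pzRingType) (N : lmodType R).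

(** [extendable t] says that [t], seen as a map on the [k]-th syzygy of [N],
    represents [0] in [Ext^k(N, W)]. *)
Definition extendable (W : lmodType R) k : {linear syzygy k N -> W} -> Prop :=
  match k return {linear syzygy k N -> W} -> Prop with
  | 0 => fun t => forall x, t x = 0
  | l.+1 => fun t => exists h : {linear resol N l -> W},
      forall x, t x = h (submod_val x)
  end.

Lemma extendable_comp (W W' : lmodType R) k (t : {linear syzygy k N -> W})
    (u : {linear W -> W'}) : extendable t -> extendable (u \o t).
Proof.
case: k t => [|k] t; first by move=> t0 x; rewrite /= t0 linear0.
by move=> [h hE]; exists (u \o h) => x; rewrite /= hE.
Qed.

Lemma extendable_ext (W : lmodType R) k (t t' : {linear syzygy k N -> W}) :
  t =1 t' -> extendable t -> extendable t'.
Proof. by move=> /linear_ext ->. Qed.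

End Extendable.

(** A complex of modules [rung i] cut into the short exact sequences
    [step i -> rung i.+1 -> step i.+1], exact on the left only for [i < g]. *)
Record ladder (R : pzRingType) (g : nat) := Ladder {
  rung : nat -> lmodType R;
  step : nat -> lmodType R;
  lad_pi : forall i, {linear rung i -> step i};
  lad_in : forall i, {linear step i -> rung i.+1};
  lad_pi_surj : forall i y, exists x, lad_pi i x = y;
  lad_exact : forall i x, lad_pi i.+1 x = 0 <-> exists y, lad_in i y = x;
  lad_in_inj : forall i, (i < g)%N -> forall y, lad_in i y = 0 -> y = 0
}.

Section Lifts.
Variables (R : pzRingType) (g : nat).
Implicit Types N : lmodType R.


Section Def.
Variables (L : ladder R g) (N : lmodType R) (c0 : {linear N -> step L g}).

Let tagged_step j (y : step L j) := Tagged (fun j => step L j : Type) y.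

(** [lifts c]: [c] is the [k]-th term of a lift of [c0] to a map from the free
    resolution of [N] to the descending complex of rungs. The index [j] equals
    [g - k] ([lifts_size]); keeping it separate avoids casts, and in degree [0]
    the equality [c = c0] is stated between dependent pairs. *)
Fixpoint lifts k : forall j, {linear syzygy k N -> step L j} -> Prop :=
  match k return forall j, {linear syzygy k N -> step L j} -> Prop with
  | 0 => fun j c => forall x, tagged_step (c x) = tagged_step (c0 x)
  | l.+1 => fun j c => exists (b : {linear syzygy l N -> step L j.+1})
      (f : {linear resol N l -> rung L j.+1}),
      [/\ lifts b, forall x, lad_pi L j.+1 (f x) = b (cover _ x) &
          forall x, lad_in L j (c x) = f (submod_val x)]
  end.

(** A lift [f] of [b] to the free cover maps the syzygy into the kernel of [lad_pi], hence into
    [step L j], which embeds in the rung because [j < g]. *)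
Lemma lifts_exists k j : (k + j)%N = g -> exists c, @lifts k j c.
Proof.
elim: k j => [|k IHk] j; first by rewrite add0n => ->; exists c0.
rewrite addSnnS => kjg; have [b bl] := IHk _ kjg.
have [|f fE] := @free_projective R _ _ _ (lad_pi L j.+1) (b \o cover (syzygy k N)).
  by move=> x; apply: lad_pi_surj.
have [||c cE] := @linear_factor_inj R _ _ _ (lad_in L j)
    (f \o @submod_val _ _ (ker (cover (syzygy k N)))).
- by apply: lad_in_inj; rewrite -kjg addnS ltnS leq_addl.
- by move=> x; apply/lad_exact; rewrite fE /= (kerP _ _ (submod_valP x)) linear0.
by exists c, b, f; split.
Qed.

Lemma lifts0 (c : {linear N -> step L g}) : @lifts 0 g c -> c =1 c0.
Proof. by move=> cl x; apply: eq_from_Tagged (cl x). Qed.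

End Def.

Lemma lifts_size (L : ladder R g) N c0 k j c :
  @lifts L N c0 k j c -> (k + j)%N = g.
Proof.
elim: k j c => [|k IHk] j c; last by move=> [b [f [/IHk E _ _]]]; rewrite addSnnS.
by move=> /(_ 0) /(congr1 (@tag _ _)).
Qed.

(** Two lifts are homotopic; [t] is the last component of the homotopy, restricted to the syzygy. *)
Lemma lifts_homotopy (L : ladder R g) N c0 k j c c' :
    @lifts L N c0 k j c -> @lifts L N c0 k j c' ->
  exists2 t : {linear syzygy k N -> rung L j}, extendable t &
    forall x, lad_pi L j (t x) = c x - c' x.
Proof.
elim: k j c c' => [|k IHk] j c c' cl cl'.
  exists \0 => // x; rewrite linear0.
  by rewrite (eq_from_Tagged (etrans (cl x) (esym (cl' x)))) subrr.
have j_lt_g : (j < g)%N by rewrite -(lifts_size cl) addSnnS leq_addl.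
case: cl => b [f [bl fE cE]]; case: cl' => b' [f' [bl' fE' cE']].
have [t _ tE] := IHk _ _ _ bl bl'.
(* The previous homotopy corrects [f - f'] to a map killed by [lad_pi], which therefore comes from
   [step L j]. *)
have [||h hE] := @linear_factor_inj R _ _ _ (lad_in L j)
    ((f \- f') \- (t \o cover (syzygy k N))).
- exact: lad_in_inj.
- by move=> x; apply/lad_exact; rewrite !linearB fE fE' tE subrr.
have [|s sE] := @free_projective R _ _ _ (lad_pi L j) h.
  by move=> x; apply: lad_pi_surj.
exists (s \o @submod_val _ _ (ker (cover (syzygy k N)))); first by exists s.
move=> x; rewrite /= sE; apply/subr0_eq/(lad_in_inj j_lt_g).
by rewrite !linearB hE /= (kerP _ _ (submod_valP x)) linear0 subr0 cE cE' -opprD subrr.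
Qed.

Lemma lifts_precomp (L : ladder R g) N N' (u : {linear N' -> N}) c0 k j c :
  @lifts L N c0 k j c -> @lifts L N' (c0 \o u) k j (c \o syzygy_map k u).
Proof.
elim: k j c => [|k IHk] j c; first by move=> cl x; apply: cl.
case=> b [f [/IHk bl fE cE]]; exists (b \o syzygy_map k u), (f \o resol_map u k).
split=> // x; last by rewrite /= cE.
by rewrite /= fE cover_map.
Qed.

Lemma lifts_postcomp (L L' : ladder R g) (v : forall i, {linear rung L i -> rung L' i})
    (w : forall i, {linear step L i -> step L' i}) N c0 k j c :
    (forall i x, lad_pi L' i (v i x) = w i (lad_pi L i x)) ->
    (forall i y, lad_in L' i (w i y) = v i.+1 (lad_in L i y)) ->
  @lifts L N c0 k j c -> @lifts L' N (w g \o c0) k j (w j \o c).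
Proof.
move=> vw wv; elim: k j c => [|k IHk] j c.
  move=> cl x; have := cl x => /= E.
  have jg : j = g := congr1 (@tag _ _) E.
  by subst j; rewrite /= (eq_from_Tagged E).
case=> b [f [/IHk bl fE cE]]; exists (w j.+1 \o b), (v j.+1 \o f).
split=> // x; last by rewrite /= wv cE.
by rewrite /= vw fE.
Qed.

(** For [k > 0] the map [f] in the definition of [lifts] is the extension. This makes evaluation at
    a boundary give the zero class. *)
Lemma lifts_in_extendable (L : ladder R g) N (c0 : {linear N -> step L g})
    (W : lmodType R) k j c (s : {linear rung L j.+1 -> W}) :
    (forall x, lad_in L g (c0 x) = 0) -> @lifts L N c0 k j c ->
  extendable (s \o (lad_in L j \o c)).
Proof.
move=> c00; case: k j c s => [|k] j c s.
  move=> cl; have jg := lifts_size cl; rewrite add0n in jg; subst j.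
  by move=> x; rewrite /= (lifts0 cl) c00 linear0.
by move=> [b [f [_ _ cE]]]; exists (s \o f) => x; rewrite /= cE.
Qed.

End Lifts.

(** * Comparison through an injective resolution *)

Section ExtVanishing.
Variables (A B : pzRingType) (V : bimod A B) (N : lmodType A).

(** With the next two lemmas, [Ext^k(N, V)] becomes the group of maps from the [k]-th syzygy to [V]
    modulo the extendable ones. *)
Lemma cover_cocycle k (t : hom V (syzygy k N)) :
  precomp (U := V) (cover (syzygy k N)) t \in ker (codiff V N k).
Proof.
apply/kerP; apply: homP => x /=.
by rewrite (kerP _ _ (submod_valP _)) linear0.
Qed.

Lemma cocycle_factor k (z : hom V (resol N k)) : codiff V N k z = 0 ->
  exists t : hom V (syzygy k N), z = precomp (U := V) (cover (syzygy k N)) t.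
Proof.
move=> z0; have [||t tE] := @linear_factor_surj _ _ _ _ (cover (syzygy k N)) z.
- exact: cover_surj.
- move=> x /syz_im[y <-].
  exact: (congr1 (fun h : hom V _ => h y) z0).
by exists t; apply: homP => x; rewrite /= tE.
Qed.

Lemma coboundary_cover k (t : hom V (syzygy k N)) :
  precomp (U := V) (cover (syzygy k N)) t \in @coboundary A B V N k <-> extendable t.
Proof.
case: k t => [|k] t.
  split=> [/eqP E x|E]; last first.
    by apply/eqP; apply: (@homP _ _ V (resol N 0)) => x /=; rewrite E.
  have [y <-] := cover_surj x.
  exact: (congr1 (fun h : hom V _ => h y) E).
split=> [/imP[h hE]|[h hE]].
  exists h => x; have [y <-] := cover_surj x.
  by have := congr1 (fun h : hom V _ => h y) hE => /= <-.
by apply/imP; exists h; apply: homP => x /=; rewrite hE.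
Qed.

Lemma Ext_zero_extendable k : zero_module (Ext V k N) ->
  forall t : {linear syzygy k N -> V}, extendable t.
Proof.
move=> Ext0 t; apply/(@coboundary_cover k t).
have := Ext0 (pi_mod _ (Submod (cover_cocycle t))).
by rewrite -(linear0 (@pi_mod _ _ _)) => /pi_modP; rewrite subr0.
Qed.

End ExtVanishing.

Section InjectiveResolution.
Variables (R : pzRingType) (U : lmodType R) (g : nat).
Variables (I : nat -> lmodType R) (e : {linear U -> I 0%N}).
Variable d : forall i, {linear I i -> I i.+1}.
Hypotheses (I_inj : forall i, injective_module (I i)) (e_inj : injective e).
Hypothesis exact0 : forall y, d 0 y = 0 <-> exists x, e x = y.
Hypothesis exactS : forall i y, d i.+1 y = 0 <-> exists x, d i x = y.
Hypothesis I_bounded : forall i, (g < i)%N -> forall y : I i, y = 0.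
Implicit Types T N : lmodType R.

Let e_inj0 x : e x = 0 -> x = 0.
Proof. by rewrite -(linear0 e) => /e_inj. Qed.

Let de0 x : d 0 (e x) = 0.
Proof. by apply/exact0; exists x. Qed.

Let dd0 i x : d i.+1 (d i x) = 0.
Proof. by apply/exactS; exists x. Qed.

(** That is, [Ext^k(T, U) = 0] for all [k > 0], computed with the injective resolution. *)
Definition acyclic T := forall k (b : {linear T -> I k.+1}),
  (forall x, d k.+1 (b x) = 0) ->
  exists s : {linear T -> I k}, forall x, d k (s x) = b x.

Lemma projective_acyclic T : projective T -> acyclic T.
Proof. by move=> Tproj k b db; apply: Tproj => x; apply/exactS. Qed.

(** Passage from vanishing computed with the free resolution to vanishing computed with the
    injective one. *)
Lemma extendable_acyclic T :
  (forall i (t : {linear syzygy i.+1 T -> U}), extendable t) -> acyclic T.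
Proof.
(* All syzygies are treated at once: lifting [b] to the free cover and restricting to the next
   syzygy lowers [k]. For [k = 0] the restriction takes values in [U], where [Text] extends it. *)
move=> Text; suff E k i (b : {linear syzygy i T -> I k.+1}) :
    (forall x, d k.+1 (b x) = 0) ->
    exists s : {linear syzygy i T -> I k}, forall x, d k (s x) = b x.
  by move=> k b db; apply: (E k 0%N).
elim: k i b => [|k IHk] i b db; pose p := cover (syzygy i T);
    pose v : {linear syzygy i.+1 T -> resol T i} := @submod_val _ _ (ker p);
    (have [|c cE] := @free_projective R _ _ _ (d _) (b \o p);
      first by move=> x; exact/exactS/db).
- have [|t tE] := @linear_factor_inj R _ _ _ e (c \o v) e_inj0.
    by move=> x; apply/exact0; rewrite cE /= (kerP _ _ (submod_valP x)) linear0.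
  have [h hE] := Text i t.
  have [|s sE] := @linear_factor_surj R _ _ _ p (c \- (e \o h)) (@cover_surj _ _).
    move=> x /kerP px; have := tE (Submod px).
    by rewrite hE /= => ->; rewrite subrr.
  exists s => y; have [x <-] := cover_surj y.
  by rewrite sE /= linearB cE de0 subr0.
- have [|m mE] := IHk i.+1 (c \o v).
    by move=> x; rewrite /= cE /= (kerP _ _ (submod_valP x)) linear0.
  have [|h hE] := @injective_module_extend R _ _ _ v m (@I_inj k).
    by move=> x x0; rewrite (_ : x = 0) ?linear0 //; apply: val_inj.
  have [|s sE] := @linear_factor_surj R _ _ _ p (c \- (d k \o h)) (@cover_surj _ _).
    move=> x /kerP px; have := mE (Submod px).
    by rewrite -hE /= => ->; rewrite subrr.
  exists s => y; have [x <-] := cover_surj y.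
  by rewrite sE /= linearB cE dd0 subr0.
Qed.

Section Comparison.
Variables (L : ladder R g) (N : lmodType R) (c0 : {linear N -> step L g}).
Hypothesis c0_inj : forall x, c0 x = 0 -> x = 0.
Hypothesis c0_exact : forall y, lad_in L g y = 0 <-> exists x, c0 x = y.
Hypothesis rung_acyclic : forall i, acyclic (rung L i).

(** For [t] with [d t = 0], [null t] says that [t] vanishes in [Ext^j] of the
    [k]-th syzygy, computed with [I]; for [j = 0] this is replaced by vanishing in
    [Ext^k(N, U)].  [step_null] is the analogue on [step L j]; [inj_at] and
    [surj_at] then say that [c] induces a bijection, and both pass from degree
    [j.+1] to [j] by dimension shifting. *)
Let null k j : {linear syzygy k N -> I j} -> Prop :=
  match j return {linear syzygy k N -> I j} -> Prop with
  | 0 => match k return {linear syzygy k N -> I 0} -> Prop with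
         | 0 => fun t => forall x, t x = 0
         | l.+1 => fun t => exists2 h : {linear resol N l -> I 0},
              forall x, d 0 (h x) = 0 & forall x, t x = h (submod_val x)
         end
  | j.+1 => fun t => exists m : {linear syzygy k N -> I j}, forall x, d j (m x) = t x
  end.

Let step_null j : {linear step L j -> I j} -> Prop :=
  match j return {linear step L j -> I j} -> Prop with
  | 0 => fun y => exists2 s : {linear rung L 1 -> I 0},
            forall x, d 0 (s x) = 0 & forall x, s (lad_in L 0 x) = y x
  | j.+1 => fun y => exists r : {linear step L j.+1 -> I j}, forall x, d j (r x) = y x
  end.

Let inj_at k j (c : {linear syzygy k N -> step L j}) :=
  forall y : {linear step L j -> I j}, (forall x, d j (y x) = 0) ->
  null (y \o c) -> step_null y.

Let surj_at k j (c : {linear syzygy k N -> step L j}) :=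
  forall n : {linear syzygy k N -> I j}, (forall x, d j (n x) = 0) ->
  exists2 y : {linear step L j -> I j},
    forall x, d j (y x) = 0 & null (n \- (y \o c)).

Let step_null_ext j (s : {linear rung L j.+1 -> I j}) (y : {linear step L j -> I j}) :
  (forall x, d j (s x) = 0) -> (forall x, s (lad_in L j x) = y x) -> step_null y.
Proof.
case: j s y => [|j] s y ds sy; first by exists s.
have [r rE] := rung_acyclic ds.
by exists (r \o lad_in L j.+1) => x /=; rewrite rE sy.
Qed.

Let step_nullD j (y z w : {linear step L j -> I j}) :
  (forall x, w x = y x + z x) -> step_null y -> step_null z -> step_null w.
Proof.
case: j y z w => [|j] y z w wE.
  move=> [r dr rE] [s ds sE]; exists (r \+ s) => x /=.
    by rewrite linearD dr ds addr0.
  by rewrite rE sE wE.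
move=> [r rE] [s sE]; exists (r \+ s) => x /=.
by rewrite linearD rE sE wE.
Qed.

Let null0 j (t : {linear N -> I j}) : (forall x, t x = 0) -> @null 0 j t.
Proof.
case: j t => [|j] t t0 //; exists \0 => x; by rewrite t0 /= linear0.
Qed.

(** With [extend_null], a criterion uniform in [j]: null maps on a syzygy are the restrictions of
    cocycles on the free module containing it. *)
Let null_extend k j (t : {linear syzygy k.+1 N -> I j}) : null t ->
  exists2 h : {linear resol N k -> I j},
    forall x, d j (h x) = 0 & forall x, t x = h (submod_val x).
Proof.
case: j t => [//|j] t [m mE].
have [|h hE] := @injective_module_extend R _ _ _
    (@submod_val _ _ (ker (cover (syzygy k N)))) m (@I_inj j).
  by move=> x x0; rewrite (_ : x = 0) ?linear0 //; apply: val_inj.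
by exists (d j \o h) => x; rewrite /= ?dd0 // hE mE.
Qed.

Let extend_null k j (t : {linear syzygy k.+1 N -> I j}) (h : {linear resol N k -> I j}) :
  (forall x, d j (h x) = 0) -> (forall x, t x = h (submod_val x)) -> null t.
Proof.
case: j t h => [|j] t h dh th; first by exists h.
have [s sE] := projective_acyclic (@free_projective _ _) dh.
by exists (s \o @submod_val _ _ (ker (cover (syzygy k N)))) => x; rewrite /= sE th.
Qed.

Let null_restrict j (c : {linear N -> step L j}) (y : {linear step L j -> I j}) :
    (forall x, c x = 0 -> x = 0) -> @null 0 j (y \o c) ->
  exists2 m : {linear step L j -> I j}, step_null m & forall x, m (c x) = y (c x).
Proof.
move=> c_inj; case: j c y c_inj => [|j] c y c_inj.
  move=> /= yc0; exists \0 => [|x]; last by rewrite yc0.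
  by exists \0 => x //=; rewrite linear0.
move=> [m mE].
have [|h hE] := @injective_module_extend R _ _ _ c m (@I_inj j).
  by move=> x /c_inj ->; rewrite linear0.
by exists (d j \o h) => [|x]; [exists h | rewrite /= hE mE].
Qed.

(** Up to a null map, [y] kills the image of [c0], which is the kernel of [lad_in L g], and so
    extends to the next rung. The extension is a cocycle because [I g.+1] is zero. *)
Let base_inj : @inj_at 0 g c0.
Proof.
move=> y _ /(null_restrict c0_inj)[m m_null mE].
have [|s sE] := @injective_module_extend R _ _ _ (lad_in L g) (y \- m) (@I_inj g).
  by move=> x /c0_exact[z <-]; rewrite /= mE subrr.
apply: (step_nullD (y := m) (z := y \- m)) => // [x|]; first by rewrite /= addrC subrK.
by apply: (step_null_ext (s := s)) => // x; apply: I_bounded.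
Qed.

Let base_surj : @surj_at 0 g c0.
Proof.
move=> n _; have [|y yE] := @injective_module_extend R _ _ _ c0 n (@I_inj g).
  by move=> x /c0_inj ->; rewrite linear0.
exists y => [x|]; first exact: I_bounded.
apply: null0 => x; by rewrite /= yE subrr.
Qed.

(** Extending [y'] to [x] on the rung and factoring [d x] through [lad_pi] gives its connecting
    image [y]. If [y] bounds [r], then [x - r lad_pi] is a cocycle extending [y']. *)
Let inj_step k j (b : {linear syzygy k N -> step L j.+1})
    (f : {linear resol N k -> rung L j.+1}) (c : {linear syzygy k.+1 N -> step L j}) :
    (j < g)%N -> (forall x, lad_pi L j.+1 (f x) = b (cover _ x)) ->
    (forall x, lad_in L j (c x) = f (submod_val x)) ->
  inj_at b -> inj_at c.
Proof.
move=> jg fE cE b_inj y' dy' /null_extend[t dt tE].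
have [|x xE] := @injective_module_extend R _ _ _ (lad_in L j) y' (@I_inj j).
  by move=> z /(lad_in_inj jg) ->; rewrite linear0.
have [|y yE] := @linear_factor_surj R _ _ _ (lad_pi L j.+1) (d j \o x)
    (@lad_pi_surj _ _ L j.+1).
  by move=> z /lad_exact[w <-]; rewrite /= xE dy'.
have [|m mE] := @linear_factor_surj R _ _ _ (cover (syzygy k N)) ((x \o f) \- t)
    (@cover_surj _ _).
  move=> z /kerP z0; rewrite /= -[z]/(submod_val (Submod z0)) -tE /= -xE cE.
  by rewrite subrr.
have [||r rE] := b_inj y.
- move=> z; have [w <-] := lad_pi_surj z; by rewrite yE /= dd0.
- exists m => z; have [w <-] := cover_surj z.
  by rewrite mE /= linearB dt subr0 -fE yE.
apply: (step_null_ext (s := x \- (r \o lad_pi L j.+1))) => z /=.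
  by rewrite linearB rE yE subrr.
have -> : lad_pi L j.+1 (lad_in L j z) = 0 by apply/lad_exact; exists z.
by rewrite linear0 subr0 xE.
Qed.

(** The connecting image [n] of [n'] is matched by some [y]. Since the rung is acyclic,
    [y lad_pi = d x], and [x] restricted to [step L j] matches [n']. *)
Let surj_step k j (b : {linear syzygy k N -> step L j.+1})
    (f : {linear resol N k -> rung L j.+1}) (c : {linear syzygy k.+1 N -> step L j}) :
    (forall x, lad_pi L j.+1 (f x) = b (cover _ x)) ->
    (forall x, lad_in L j (c x) = f (submod_val x)) ->
  surj_at b -> surj_at c.
Proof.
move=> fE cE b_surj n' dn'.
pose v : {linear syzygy k.+1 N -> resol N k} :=
  @submod_val _ _ (ker (cover (syzygy k N))).
have [|f1 f1E] := @injective_module_extend R _ _ _ v n' (@I_inj j).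
  by move=> x x0; rewrite (_ : x = 0) ?linear0 //; apply: val_inj.
have [|n nE] := @linear_factor_surj R _ _ _ (cover (syzygy k N)) (d j \o f1)
    (@cover_surj _ _).
  by move=> x /kerP x0; rewrite /= -[x]/(v (Submod x0)) f1E dn'.
have [|y dy [m mE]] := b_surj n.
  by move=> z; have [w <-] := cover_surj z; rewrite nE /= dd0.
have [|x xE] := rung_acyclic (b := y \o lad_pi L j.+1).
  by move=> z; rewrite /= dy.
exists (x \o lad_in L j) => [z|] /=.
  rewrite xE /=.
  have -> : lad_pi L j.+1 (lad_in L j z) = 0 by apply/lad_exact; exists z.
  by rewrite linear0.
apply: (extend_null (h := (f1 \- (x \o f)) \- (m \o cover (syzygy k N)))) => z /=.
  rewrite !linearB xE /= fE mE /= nE /=.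
  by rewrite subrr.
by rewrite (kerP _ _ (submod_valP z)) linear0 subr0 cE f1E.
Qed.

Let lifts_inj_surj k j (c : {linear syzygy k N -> step L j}) :
  lifts c0 c -> inj_at c /\ surj_at c.
Proof.
elim: k j c => [|k IHk] j c cl.
  have E := lifts_size cl; rewrite add0n in E; subst j.
  by rewrite (linear_ext (lifts0 cl)); split; [apply: base_inj | apply: base_surj].
have jg : (j < g)%N by rewrite -(lifts_size cl) addSnnS leq_addl.
case: cl => b [f [/IHk[b_inj b_surj] fE cE]].
by split; [apply: inj_step fE cE _ | apply: surj_step fE cE _].
Qed.

Let extendable_null k (u : {linear syzygy k N -> U}) (t : {linear syzygy k N -> I 0}) :
  (forall x, t x = e (u x)) -> extendable u -> null t.
Proof.
case: k u t => [|k] u t tE; first by move=> u0 x; rewrite tE u0 linear0.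
by move=> [h hE]; exists (e \o h) => x; rewrite /= ?de0 // tE hE.
Qed.

Let null_extendable k (u : {linear syzygy k N -> U}) (t : {linear syzygy k N -> I 0}) :
  (forall x, t x = e (u x)) -> null t -> extendable u.
Proof.
case: k u t => [|k] u t tE; first by move=> t0 x; apply: e_inj0; rewrite -tE t0.
move=> [h dh hE]; have [|r rE] := @linear_factor_inj R _ _ _ e h e_inj0.
  by move=> x; apply/exact0.
by exists r => x; apply: e_inj; rewrite rE -hE tE.
Qed.

Lemma lifts_injective (c : {linear syzygy g N -> step L 0}) (y : {linear step L 0 -> U}) :
    lifts c0 c -> extendable (y \o c) ->
  exists s : {linear rung L 1 -> U}, forall x, s (lad_in L 0 x) = y x.
Proof.
move=> /lifts_inj_surj[c_inj _] yc.
have [||s ds sE] := c_inj (e \o y).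
- by move=> x; apply: de0.
- exact: (extendable_null (u := y \o c)).
have [|r rE] := @linear_factor_inj R _ _ _ e s e_inj0.
  by move=> x; apply/exact0.
by exists r => x; apply: e_inj; rewrite rE sE.
Qed.

Lemma lifts_surjective (c : {linear syzygy g N -> step L 0})
    (n : {linear syzygy g N -> U}) :
    lifts c0 c ->
  exists y : {linear step L 0 -> U}, extendable (n \- (y \o c)).
Proof.
move=> /lifts_inj_surj[_ c_surj].
have [|z dz zn] := c_surj (e \o n); first by move=> x; apply: de0.
have [|y yE] := @linear_factor_inj R _ _ _ e z e_inj0.
  by move=> x; apply/exact0.
exists y; apply: null_extendable zn => x.
by rewrite /= linearB yE.
Qed.

End Comparison.
End InjectiveResolution.

(** * The dual of a finite free resolution *)

Section FreeDual.
Variables (A B : pzRingType) (U : bimod A B).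
Implicit Types T : lmodType A.

Definition reflexive T :=
  (forall p : {linear hom U T -> flip U}, exists x, forall h : hom U T, p h = h x) /\
  (forall x : T, (forall h : hom U T, h x = 0) -> x = 0).

Section Coordinates.
Variable n : nat.
Let T : lmodType A := free A 'I_n.

Fact coord_in_linear (i : 'I_n) (u : flip U) :
  linear (fun x : T => coeff x i *: (u : U)).
Proof. by move=> a x y; rewrite coeffP scalerDl scalerA. Qed.

Definition coord_in_fun (i : 'I_n) (u : flip U) : hom U T :=
  mk_linear (coord_in_linear i u).

Fact coord_in_fun_linear i : linear (coord_in_fun i).
Proof.
move=> b u w; apply: homP => x /=.
by rewrite scalerDr -bimod_actC.
Qed.

(** [coord_in] and [coord_out] identify [hom U T] with [n] copies of [flip U]. *)
Definition coord_in i : {linear flip U -> hom U T} := mk_linear (@coord_in_fun_linear i).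

Fact coord_out_linear (i : 'I_n) : linear (fun h : hom U T => (h (delta A i) : flip U)).
Proof. by []. Qed.

Definition coord_out i : {linear hom U T -> flip U} := mk_linear (@coord_out_linear i).

Lemma coord_sum (h : hom U T) : h = \sum_i coord_in i (coord_out i h).
Proof.
apply: homP => x.
rewrite (big_morph (fun h : hom U T => h x) (id1 := 0) (op1 := +%R)) //.
rewrite [in LHS](free_fin_sum x) linear_sum; apply: eq_bigr => i _.
by rewrite linearZ.
Qed.

(** On each coordinate [p] is an endomorphism of [flip U], hence a homothety by a unique element of
    [A]. *)
Lemma free_reflexive : faithfully_balanced U -> reflexive T.
Proof.
move=> [[r rK Kr] _]; split=> [p|x x0].
  exists (\sum_i r (p \o coord_in i) *: delta A i) => h.
  rewrite {1}[h]coord_sum !linear_sum; apply: eq_bigr => i _.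
  rewrite linearZ.
  exact: esym (congr1 (fun q : {linear flip U -> flip U} => q (coord_out i h))
    (Kr (p \o coord_in i))).
apply: coeff_inj => i; apply: (can_inj rK); apply: linear_ext => u.
change (coeff x i *: (u : U) = coeff (0 : T) i *: (u : U)).
have c0 : coeff (0 : T) i = 0 by [].
by rewrite c0 scale0r -[LHS]/(coord_in i u x) x0.
Qed.

Lemma fingen_dual_free : fingen (flip U) -> fingen (hom U T).
Proof.
move=> [m [s sE]].
exists #|{: 'I_n * 'I_m}|, (fun k => let: (i, j) := enum_val k in coord_in i (s j)) => h.
have [a aE] := choice (fun i => sE (coord_out i h)).
exists (fun k => let: (i, j) := enum_val k in a i j).
rewrite {1}[h]coord_sum.
under eq_bigr => i _ do rewrite aE linear_sum.
rewrite pair_bigA /= (big_enum_val (A := predT)) /=.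
apply: eq_bigr => k _; case: (enum_val k) => i j /=.
by rewrite -[LHS]/(coord_in i (a i j *: s j)) linearZ.
Qed.

Lemma acyclic_dual_free (I : nat -> lmodType B) (d : forall i, {linear I i -> I i.+1}) :
  acyclic d (flip U) -> acyclic d (hom U T).
Proof.
move=> Uac k b db.
have /choice[s sE] i : exists s : {linear flip U -> I k},
    forall u, d k (s u) = b (coord_in i u).
  by apply: (Uac k (b \o coord_in i)) => u; apply: db.
have t_lin : linear (fun h => \sum_i s i (coord_out i h)).
  move=> a h h'; rewrite scaler_sumr -big_split; apply: eq_bigr => i _.
  by rewrite !linearP.
exists (mk_linear t_lin) => h /=.
rewrite [in RHS](coord_sum h) !linear_sum; apply: eq_bigr => i _.
exact: sE.
Qed.

End Coordinates.

Definition eval_at T (x : T) (h : hom U T) : flip U := h x.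

Fact eval_at_linear T (x : T) : linear (eval_at x).
Proof. by []. Qed.

End FreeDual.

Section DualLadder.
Variables (A B : pzRingType) (U : bimod A B) (M : lmodType A) (g : nat).
Hypothesis M_grade : grade_ge U M g.
Variable C : resolution M.

(** [Ext] is defined by the standard resolution only; comparison maps [u] and [v] in both
    directions, with [u v] homotopic to the identity, transfer its vanishing to [C]. *)
Lemma Ext_zero_cob i : zero_module (Ext U i M) ->
  forall y, res_codiff U C i y = 0 -> y \in cob U C i.
Proof.
move=> Ext0 y y0.
have [u uC] := chain_map_exists (std_resolution M) C idfun.
have [v vC] := chain_map_exists C (std_resolution M) idfun.
have yuE := cocycle_precomp uC y0.
have /kerP yu0 : precomp (U := U) (u i) y \in ker (codiff U M i) by apply/kerP.
have := Ext0 (pi_mod _ (Submod (introT (kerP _ _) yu0))).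
rewrite -(linear0 (@pi_mod _ _ _)) => /pi_modP; rewrite subr0 => yu_cob.
have yuv_cob := cob_precomp vC (yu_cob : _ \in cob U (std_resolution M) i).
have := cob_homotopic (chain_map_comp vC uC) (chain_map_id C) (fun=> erefl) y0.
move=> /(rpredB yuv_cob).
congr (is_true (in_mem _ _)); apply: homP => x /=.
by rewrite opprB addrC subrK.
Qed.


(** The cokernel of the dual differential into degree [i]; for [i = g] it is the module [Y] of the
    overview. *)
Definition dual_step i : lmodType B := quotmod (cob U C i).

Lemma codiff_cob i h : h \in cob U C i -> res_codiff U C i h = 0.
Proof.
case: i h => [|i] h; first by move=> /eqP ->; rewrite linear0.
by move=> /imP[k <-]; apply: homP => x /=; rewrite res_diff_diff linear0.
Qed.

Definition dual_in_fun i (q : dual_step i) : hom U (C i.+1) :=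
  res_codiff U C i (repr q).

Lemma dual_in_funE i h : @dual_in_fun i (pi_mod _ h) = res_codiff U C i h.
Proof.
apply/subr0_eq; rewrite -linearB; apply: codiff_cob.
by apply/pi_modP; rewrite pi_mod_repr.
Qed.

Fact dual_in_linear i : linear (@dual_in_fun i).
Proof.
move=> a p q; rewrite -(pi_mod_repr q) -(pi_mod_repr p) -linearP.
by rewrite !dual_in_funE linearP.
Qed.

Definition dual_in i : {linear dual_step i -> hom U (C i.+1)} :=
  mk_linear (@dual_in_linear i).

Lemma pi_mod_surj i (y : dual_step i) : exists x, pi_mod (cob U C i) x = y.
Proof. by exists (repr y); apply: pi_mod_repr. Qed.

Lemma pi_mod0 i x : pi_mod (cob U C i) x = 0 <-> x \in cob U C i.
Proof. by rewrite -(linear0 (@pi_mod _ _ _)) -{2}[x]subr0; apply: pi_modP. Qed.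

Lemma dual_exact i x :
  pi_mod (cob U C i.+1) x = 0 <-> exists y, dual_in i y = x.
Proof.
split=> [/pi_mod0/imP[h <-]|[y <-]].
  by exists (pi_mod _ h); apply: dual_in_funE.
by apply/pi_mod0/imP; exists (repr y).
Qed.

Lemma dual_in_inj i : (i < g)%N -> forall y, dual_in i y = 0 -> y = 0.
Proof.
move=> /M_grade Ext0 y; have [h <-] := pi_mod_surj y.
by rewrite /= dual_in_funE => /(Ext_zero_cob Ext0)/pi_mod0.
Qed.

Definition dual_ladder : ladder B g :=
  @Ladder B g (fun i => hom U (C i)) dual_step (fun i => @pi_mod _ _ (cob U C i))
    dual_in pi_mod_surj dual_exact dual_in_inj.

Section Compare.
Variables (v : forall i, {linear C i -> resol M i}).
Hypothesis vC : chain_map (C := C) (D := std_resolution M) id v.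

Fact compare_boundary :
  {in preim_sub (@submod_val _ _ (ker (codiff U M g))) (@coboundary A B U M g),
    forall z, (precomp (U := U) (v g) \o @submod_val _ _ (ker (codiff U M g))) z
      \in cob U C g}.
Proof. by move=> z zc; apply: (cob_precomp vC) zc. Qed.

(** The embedding of [E] in [Y]. *)
Definition compare : {linear Ext U g M -> step dual_ladder g} :=
  quotmod_map compare_boundary.

Lemma compareE z :
  compare (pi_mod _ z) = pi_mod _ (precomp (U := U) (v g) (submod_val z)).
Proof. exact: quotmod_mapE. Qed.

Lemma compare_inj q : compare q = 0 -> q = 0.
Proof.
rewrite -(pi_mod_repr q) compareE => /pi_mod0 vz_cob.
set z := repr q in vz_cob *.
rewrite -(linear0 (@pi_mod _ _ _)); apply/pi_modP; rewrite subr0.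
have z0 := kerP _ _ (submod_valP z).
have [u uC] := chain_map_exists (std_resolution M) C idfun.
have zvu_cob := cob_precomp uC vz_cob.
have := cob_homotopic (chain_map_comp uC vC) (chain_map_id (std_resolution M))
  (fun=> erefl) z0.
move=> /(rpredB zvu_cob).
congr (is_true (in_mem _ _)); apply: homP => x /=.
by rewrite opprB addrC subrK.
Qed.

Lemma compare_exact y : lad_in dual_ladder g y = 0 <-> exists q, compare q = y.
Proof.
split=> [|[q <-]]; last first.
  rewrite -(pi_mod_repr q) compareE /= dual_in_funE.
  exact: (cocycle_precomp vC (kerP _ _ (submod_valP (repr q)))).
have [h <-] := pi_mod_surj y; rewrite /= dual_in_funE => h0.
have [u uC] := chain_map_exists (std_resolution M) C idfun.
have hu0 := cocycle_precomp uC h0.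
exists (pi_mod _ (Submod (introT (kerP (codiff U M g) _) hu0))).
apply: etrans (compareE _) _; apply/pi_modP.
have := cob_homotopic (chain_map_comp vC uC) (chain_map_id C) (fun=> erefl) h0.
by congr (is_true (in_mem _ _)); apply: homP.
Qed.

End Compare.

Definition eval_step_fun (x : C 0%N) (q : dual_step 0) : flip U := eval_at x (repr q).

Lemma eval_step_funE x h : eval_step_fun x (pi_mod _ h) = eval_at x h.
Proof.
have /pi_modP/eqP/subr0_eq E := pi_mod_repr (pi_mod (cob U C 0) h).
by rewrite /eval_step_fun E.
Qed.

Fact eval_step_linear x : linear (eval_step_fun x).
Proof.
move=> a p q; rewrite -(pi_mod_repr q) -(pi_mod_repr p) -linearP.
by rewrite !eval_step_funE.
Qed.

Definition eval_step x : {linear dual_step 0 -> flip U} :=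
  mk_linear (@eval_step_linear x).

Section Biduality.
Variable c : {linear syzygy g (Ext U g M) -> dual_step 0}.

Definition bidual_fun (x : C 0%N) : Ext (flip U) g (Ext U g M) :=
  pi_mod _ (Submod (cover_cocycle (V := flip U) (eval_step x \o c))).

Fact bidual_linear : linear bidual_fun.
Proof.
move=> a x y; rewrite /bidual_fun -linearP; congr (pi_mod _ _).
apply: val_inj; apply: homP => z /=.
by rewrite /eval_step_fun /eval_at linearP.
Qed.

Definition bidual : {linear C 0%N -> Ext (flip U) g (Ext U g M)} :=
  mk_linear bidual_linear.

Lemma bidual_eq0 x : bidual x = 0 <-> extendable (eval_step x \o c).
Proof.
rewrite -(@coboundary_cover _ _ (flip U)) -(linear0 (@pi_mod _ _ _)).
by apply: iff_trans (pi_modP _ _ _) _; rewrite subr0.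
Qed.

End Biduality.

End DualLadder.

(** * The bidual map *)

Section Bidual.
Variables (A B : pzRingType) (U : bimod A B) (g : nat).
Implicit Types M : lmodType A.

(** [bidual_map h] holds when [h] is the comparison map computed from some finite
    free resolution of [M] and some choice of lifts. *)
Definition bidual_map M (h : {linear M -> Ext (flip U) g (Ext U g M)}) : Prop :=
  exists (Mg : grade_ge U M g) (C : resolution M)
         (v : forall i, {linear C i -> resol M i})
         (vC : chain_map (C := C) (D := std_resolution M) id v)
         (c : {linear syzygy g (Ext U g M) -> step (dual_ladder Mg C) 0}),
    [/\ forall i, finite_free (C i),
        lifts (compare Mg vC) c &
        forall x, h (res_aug C x) = bidual c x].

Lemma bidual_map_exists M : left_noetherian A -> fingen M -> grade_ge U M g ->
  exists h, bidual_map (M := M) h.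
Proof.
move=> A_noeth M_fg Mg.
have [C C_free] := finite_free_resolution A_noeth M_fg.
have [v vC] := chain_map_exists C (std_resolution M) idfun.
have [c cl] := lifts_exists (compare Mg vC) (addn0 g).
have [|h hE] := @linear_factor_surj _ _ _ _ (res_aug C) (bidual c) (@res_aug_surj _ _ C).
  move=> x /res_exact0[x' <-]; apply/bidual_eq0.
  (* Evaluation at the boundary of [x'] is evaluation at [x'] preceded by [lad_in] in degree 0. *)
  have s_lin : linear (fun h : hom U (C 1%N) => (h x' : flip U)) by [].
  have c0 q : lad_in (dual_ladder Mg C) g (compare Mg vC q) = 0.
    by apply: (proj2 (compare_exact (M_grade := Mg) vC _)); exists q.
  pose s : {linear rung (dual_ladder Mg C) 1 -> flip U} := mk_linear s_lin.
  exact: (@extendable_ext _ _ _ _ _ _ _ (lifts_in_extendable s c0 cl)).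
by exists h, Mg, C, v, vC, c.
Qed.

Lemma bidual_map_natural M M' (f : {linear M -> M'}) h h' :
    bidual_map (M := M) h -> bidual_map (M := M') h' ->
  forall x, h' (f x) = Ext_map (flip U) g (Ext_map U g f) (h x).
Proof.
move=> [Mg [C [v [vC [c [_ cl hE]]]]]] [Mg' [C' [v' [vC' [c' [_ cl' hE']]]]]] x.
have [y <-] := res_aug_surj C x.
have [u uC] := chain_map_exists C C' f.
have [u0 uS] := uC.
set fE := Ext_map U g f.
have cobu i : {in cob U C' i, forall z, precomp (U := U) (u i) z \in cob U C i}.
  by move=> z; apply: cob_precomp uC.
pose w i : {linear dual_step U C' i -> dual_step U C i} := quotmod_map (cobu i).
have wE i z : w i (pi_mod _ z) = pi_mod _ (precomp (U := U) (u i) z).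
  exact: quotmod_mapE.
have w_in i q : dual_in U C i (w i q) = precomp (U := U) (u i.+1) (dual_in U C' i q).
  rewrite -(pi_mod_repr q) wE /= !dual_in_funE.
  by apply: homP => z /=; rewrite uS.
have ev_w q : eval_step U y (w 0%N q) = eval_step U (u 0%N y) q :> flip U.
  by rewrite -(pi_mod_repr q) wE /= !eval_step_funE.
have base_eq q : compare Mg vC (fE q) = w g (compare Mg' vC' q).
  rewrite -(pi_mod_repr q) /fE Ext_mapE !compareE wE; apply/pi_modP.
  have := cob_homotopic (chain_map_comp vC (std_chain_map f)) (chain_map_comp uC vC')
    (fun=> erefl) (kerP _ _ (submod_valP (repr q))).
  by congr (is_true (in_mem _ _)); apply: homP.
(* Both ways around the square give lifts of the same map, so they are homotopic; evaluating the
   homotopy at [y] gives an extendable difference. *)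
have cl1 := lifts_precomp fE cl.
have cl2 := @lifts_postcomp _ g (dual_ladder Mg' C') (dual_ladder Mg C)
  (fun i => precomp (U := U) (u i)) w _ _ _ _ _ (fun i z => esym (wE i z)) w_in cl'.
rewrite (linear_ext (f := compare Mg vC \o fE) (g := w g \o compare Mg' vC')
  base_eq) in cl1.
have [t t_ext tE] := lifts_homotopy cl1 cl2.
have ev_t z : eval_at (U := U) y (t z) =
    eval_step U y (c (syzygy_map g fE z)) - eval_step U (u 0%N y) (c' z).
  rewrite -ev_w -linearB -[in RHS]tE /=.
  by rewrite eval_step_funE.
rewrite hE -u0 hE'; apply/esym; rewrite -[bidual c y]/(bidual_fun c y) /bidual_fun.
rewrite Ext_mapE.
apply/pi_modP.
pose ev : {linear rung (dual_ladder Mg C) 0 -> flip U} :=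
  mk_linear (@eval_at_linear _ _ U _ y).
have := (@coboundary_cover _ _ (flip U) _ _ _).2 (extendable_comp ev t_ext).
congr (is_true (in_mem _ _)); apply: homP => z.
rewrite /= -[LHS]/(eval_at y (t (cover _ z))) ev_t.
by rewrite -cover_map.
Qed.

Lemma bidual_map_bijective M h :
    faithfully_balanced U ->
    (forall i, (0 < i)%N -> zero_module (Ext (flip U) i (flip U))) ->
    injdim_le (flip U) g ->
  bidual_map (M := M) h -> bijective h.
Proof.
move=> U_bal U_ext [I [e [d [I_inj e_inj exact0 exactS I_bounded]]]].
move=> [Mg [C [v [vC [c [C_free cl hE]]]]]].
have C_refl i : reflexive U (C i) by have [n ->] := C_free i; apply: free_reflexive.
have L_acyclic i : acyclic d (rung (dual_ladder Mg C) i).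
  rewrite /=; have [n ->] := C_free i; apply: acyclic_dual_free.
  apply: (extendable_acyclic I_inj e_inj exact0 exactS) => k t.
  by apply: (@Ext_zero_extendable _ _ (flip U)); apply: U_ext.
have c_inj q : compare Mg vC q = 0 -> q = 0 by apply: compare_inj.
have c_exact := compare_exact (M_grade := Mg) vC.
have h_inj x : h x = 0 -> x = 0.
  have [y <-] := res_aug_surj C x; rewrite hE => /bidual_eq0 y_ext.
  (* Evaluation at [y] extends to [s] on the dual of [C 1], and [s] is evaluation at some [y']. Then
     [y] and the boundary of [y'] agree under every functional, hence are equal. *)
  have [s sE] := lifts_injective I_inj e_inj exact0 exactS I_bounded
    c_inj c_exact L_acyclic cl y_ext.
  have [y' y'E] := (C_refl 1%N).1 s.
  apply/res_exact0; exists y'; apply/esym/subr0_eq/(C_refl 0%N).2 => k.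
  have := sE (pi_mod _ k); rewrite /= y'E dual_in_funE eval_step_funE.
  by rewrite linearB => /= ->; apply: subrr.
have h_surj q : exists x, h x = q.
  rewrite -(pi_mod_repr q); set z := repr q.
  have [n nE] := cocycle_factor (kerP _ _ (submod_valP z)).
  (* Modulo extendable maps [n] is [y \o c], and reflexivity of [C 0] turns [y] into evaluation at
     some [x]. *)
  have [y y_ext] := lifts_surjective I_inj e_inj exact0 exactS I_bounded
    c_inj c_exact L_acyclic n cl.
  have [x xE] := (C_refl 0%N).1 (y \o lad_pi (dual_ladder Mg C) 0).
  have yE p : y p = eval_step U x p.
    by rewrite -(pi_mod_repr p) /= eval_step_funE -[RHS]xE.
  exists (res_aug C x); rewrite hE; apply/esym/pi_modP.
  have := (@coboundary_cover _ _ (flip U) _ _ _).2 y_ext.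
  congr (is_true (in_mem _ _)); apply: homP => w.
  by rewrite /= nE /= yE.
have [k kE] := choice h_surj.
exists k => // x; apply/subr0_eq/h_inj.
by rewrite linearB kE subrr.
Qed.

End Bidual.

(** * Duality *)

(** The equality of carriers is a separate argument so that it can be given as
    [erefl] when it holds by conversion, which makes the last premise computable. *)
Lemma bimod_ext (A B : pzRingType) (U V : bimod A B)
    (LE : bimod_left U = bimod_left V) (TE : bimod_left U = bimod_left V :> Type) :
  eq_rect _ (fun T : Type => B -> T -> T) (@bimod_act _ _ U) _ TE = @bimod_act _ _ V ->
  U = V.
Proof.
case: U LE TE => L a a1 a2 a3 a4 a5; case: V => L' b b1 b2 b3 b4 b5 /= LE.
case: L' / LE b b1 b2 b3 b4 b5 => b b1 b2 b3 b4 b5 TE.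
rewrite (Prop_irrelevance TE erefl) /= => ab; case: b / ab b1 b2 b3 b4 b5 => *.
congr Bimod; exact: Prop_irrelevance.
Qed.

Ltac hnf_lhs :=
  match goal with |- ?m = _ => let m' := eval hnf in m in change m with m' end.

(** The operations agree by computation; only the proofs of the axioms have to be identified. *)
Lemma flip_flip (A B : pzRingType) (U : bimod A B) : flip (flip U) = U.
Proof.
apply: (@bimod_ext _ _ (flip (flip U)) U _ erefl); last by [].
case: U => L act actA act1 actDr actDl actC.
case: L act actA act1 actDr actDl actC => T [? ? ? ? ? ? ? ? ? [? ? ? ? ? ?]] *.
hnf_lhs; congr (GRing.Lmodule.Pack _).
hnf_lhs; congr (GRing.Lmodule.Class _).
hnf_lhs; congr GRing.Nmodule_isLSemiModule.Axioms_; exact: Prop_irrelevance.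
Qed.

Section ExtModules.
Variables (A B : pzRingType) (U : bimod A B).
Implicit Types M N : lmodType A.

Lemma Ext_zero_retract i M N (f : {linear M -> N}) (r : {linear N -> M}) :
  (forall x, r (f x) = x) -> zero_module (Ext U i N) -> zero_module (Ext U i M).
Proof.
move=> rf Ext0 q; rewrite -(Ext_map_id (f := idfun) (fun=> erefl) q).
rewrite (@Ext_map_comp _ _ _ _ _ _ _ f r idfun (fun x => esym (rf x))) /comp.
by rewrite (Ext0 (Ext_map U i r q)) linear0.
Qed.

(** When [M] is zero, the identity chain map lies over the zero map, so every cocycle is a
    coboundary. *)
Lemma Ext_of_zero i M : zero_module M -> zero_module (Ext U i M).
Proof.
move=> M0 q; rewrite -(pi_mod_repr q); set z := repr q.
rewrite -(linear0 (@pi_mod _ _ _)); apply/pi_modP; rewrite subr0.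
pose F := std_resolution M.
have idC : chain_map (C := F) (D := F) (fun=> 0) (fun=> idfun).
  by split=> // x; apply: M0.
have := cob_null idC (kerP _ _ (submod_valP z)).
by congr (is_true (in_mem _ _)); apply: homP.
Qed.

Lemma sgrade_ge_grade_ge M n : sgrade_ge U M n -> grade_ge U M n.
Proof.
move=> Mn i /(Mn (ker (\0 : {linear M -> M}))).
have K x : x \in ker (\0 : {linear M -> M}) by apply/kerP.
have f_lin : linear (fun x => Submod (K x)) by move=> a x y; apply: val_inj.
exact: (Ext_zero_retract (f := mk_linear f_lin) (r := @submod_val _ _ _)).
Qed.

(** [compare] embeds [Ext U g M] in a quotient of the dual of [C g], a finite sum of copies of
    [flip U]. *)
Lemma fingen_Ext M g : left_noetherian A -> left_noetherian B -> fingen (flip U) ->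
  fingen M -> grade_ge U M g -> fingen (Ext U g M).
Proof.
move=> A_noeth B_noeth U_fg M_fg Mg.
have [C C_free] := finite_free_resolution A_noeth M_fg.
have [v vC] := chain_map_exists C (std_resolution M) idfun.
apply: (fingen_inj B_noeth (i := compare Mg vC)).
  exact: compare_inj.
apply: (fingen_surj (p := lad_pi (dual_ladder Mg C) g) (@lad_pi_surj _ _ _ _)).
by rewrite /=; have [n ->] := C_free g; apply: fingen_dual_free.
Qed.

End ExtModules.

Section Duality.
Variables (A B : pzRingType) (U : bimod A B) (g : nat).
Hypotheses (A_noeth : left_noetherian A) (B_noeth : left_noetherian B).
Hypotheses (U_fg : fingen (flip U)) (U_bal : faithfully_balanced U).
Hypothesis U_ext : forall i, (0 < i)%N -> zero_module (Ext (flip U) i (flip U)).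
Hypothesis U_injdim : injdim_le (flip U) g.
Implicit Types M N : lmodType A.

(** The maps can be chosen independently for each module, since naturality holds between any two
    maps satisfying [bidual_map]. *)
Lemma bidual_natiso : exists eta : forall M, has_grade U g M ->
    {linear M -> Ext (flip U) g (Ext U g M)},
  (forall M Mg, bijective (eta M Mg)) /\
  forall M N Mg Ng (f : {linear M -> N}) x,
    eta N Ng (f x) = Ext_map (flip U) g (Ext_map U g f) (eta M Mg x).
Proof.
pose eta M (Mg : has_grade U g M) := cid (bidual_map_exists A_noeth Mg.1 Mg.2.1).
exists (fun M Mg => sval (eta M Mg)); split=> [M Mg|M N Mg Ng f x].
  exact: bidual_map_bijective U_bal U_ext U_injdim (svalP (eta M Mg)).
exact: bidual_map_natural (svalP (eta M Mg)) (svalP (eta N Ng)) x.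
Qed.

(** The guard [0 < g] matches the Gorenstein condition, which is stated in positive degrees; for
    [g = 0] the lower bound is vacuous. *)
Lemma has_grade_Ext M :
    ((0 < g)%N -> sgrade_ge (flip U) (Ext U g M) g) ->
  has_grade U g M -> has_grade (flip U) g (Ext U g M).
Proof.
move=> sg [M_fg [Mg Mg1]]; split; first exact: fingen_Ext.
split=> [j jg|].
  exact: sgrade_ge_grade_ge (sg (leq_ltn_trans (leq0n j) jg)) _ jg.
(* If the double [Ext] vanished, the bidual isomorphism would make [M] zero, and then [Ext U g M]
   would vanish too. *)
move=> /(_ g (ltnSn g)) E0; apply: Mg1 => j.
rewrite ltnS leq_eqVlt => /predU1P[->|]; last exact: Mg.
have [h h_bidual] := bidual_map_exists A_noeth M_fg Mg.
have [k hK _] := bidual_map_bijective U_bal U_ext U_injdim h_bidual.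
by apply: Ext_of_zero => x; apply: (can_inj hK); rewrite (E0 (h x)) linear0.
Qed.

End Duality.

Theorem theorem4p1 (Lambda Gamma : pzRingType) (U : bimodule Lambda Gamma) (g : nat)
    (Lambda_noeth : left_noetherian Lambda /\ right_noetherian Lambda)
    (Gamma_noeth : left_noetherian Gamma /\ right_noetherian Gamma)
    (U_fingen : fingen U /\ fingen (flip U))
    (U_balanced : faithfully_balanced U)
    (U_selforth : selforthogonal U)
    (U_gorenstein : gorenstein U) :
  (injdim_eq (flip U) g ->
     forall M : lmodType Lambda, has_grade U g M -> (exists x : M, x != 0) ->
       isomorphic M (Ext (flip U) g (Ext U g M))) /\
  (injdim_eq (flip U) g -> injdim_eq U g ->
     exists Ext_has_grade : forall M : lmodType Lambda,
         has_grade U g M -> has_grade (flip U) g (Ext U g M),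
       is_duality (Ext_functor Ext_has_grade)).
Proof.
case: Lambda_noeth => L_noeth _; case: Gamma_noeth => _ G_noeth.
case: U_fingen => U_fg fU_fg; case: U_gorenstein => gor_r gor_l.
have fU_ext i : (0 < i)%N -> zero_module (Ext (flip U) i (flip U)).
  by move=> /U_selforth[].
split=> [fU_injdim M M_grade _|[fU_injdim _] [U_injdim _]].
  have [eta [eta_bij _]] := bidual_natiso L_noeth U_balanced fU_ext fU_injdim.1.
  by exists (eta M M_grade).
have gradeF M : has_grade U g M -> has_grade (flip U) g (Ext U g M).
  move=> M_grade; apply: has_grade_Ext => //.
  exact: gor_l M_grade.1.
have [eta [eta_bij eta_nat]] := bidual_natiso L_noeth U_balanced fU_ext fU_injdim.
have U_ext i : (0 < i)%N -> zero_module (Ext U i U) by move=> /U_selforth[].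
have fU_balanced : faithfully_balanced (flip U).
  by case: U_balanced => ? ?; split; rewrite ?flip_flip.
have gradeG N : has_grade (flip U) g N -> has_grade U g (Ext (flip U) g N).
  (* The results for [flip U] exchange the two rings, and [flip_flip] restores [U]. *)
  have := @has_grade_Ext _ _ (flip U) g G_noeth; rewrite flip_flip.
  move=> /(_ L_noeth U_fg fU_balanced U_ext U_injdim N) + N_grade; apply=> //.
  exact: gor_r N_grade.1.
have := @bidual_natiso _ _ (flip U) g G_noeth; rewrite flip_flip.
move=> /(_ fU_balanced U_ext U_injdim)[theta [theta_bij theta_nat]].
exists gradeF, (Ext_functor gradeG); split.
  exists (fun M : fullsub (has_grade U g) => eta M (fullsubP M)).
  split=> [M|M N f x]; first exact: eta_bij.
  exact: eta_nat.
exists (fun N : fullsub (has_grade (flip U) g) => theta N (fullsubP N)).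
split=> [N|N N' f x]; first exact: theta_bij.
exact: theta_nat.
Qed.
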